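(* One can construct a biequivalence between the bicategory of monads internal to $\mathsf{Cat}$ and the bicategory of Kleisli triples.
   Context: We work in Martin-Löf type theory with function extensionality (univalent foundations). $\mathsf{Cat}$ is the bicategory of univalent categories, functors and natural transformations (a category is univalent if the canonical maps from $(x=y)$ to the type of isomorphisms $x\cong y$ are equivalences). Composition of morphisms, 1-cells and pseudofunctors is written in diagrammatic order; $\bullet$ is vertical composition, $\vartriangleleft,\vartriangleright$ are left and right whiskering; $\lambda,\rho$ are unitors, $\alpha(f,g,h):f\cdot(g\cdot h)\Rightarrow(f\cdot g)\cdot h$ associators. Bicategory of monads internal to a bicategory $\mathsf{B}$ (used with $\mathsf{B}=\mathsf{Cat}$). Objects: $(a,m_a,\eta_a,\mu_a)$ with $a:\mathsf{B}_0$, a 1-cell $m_a:a\to a$, and 2-cells $\eta_a:\mathrm{id}_1(a)\Rightarrow m_a$, $\mu_a:m_a\cdot m_a\Rightarrow m_a$ satisfying the unit laws $(m_a\vartriangleleft\eta_a)\bullet\mu_a=\rho(m_a)$, $(\eta_a\vartriangleright m_a)\bullet\mu_a=\lambda(m_a)$ and associativity $(m_a\vartriangleleft\mu_a)\bullet\mu_a=\alpha(m_a,m_a,m_a)\bullet(\mu_a\vartriangleright m_a)\bullet\mu_a$. 1-cells: a 1-cell $f:a\to b$ with an invertible 2-cell $n_f:m_a\cdot f\Rightarrow f\cdot m_b$ such that $(\eta_a\vartriangleright f)\bullet n_f=\lambda(f)\bullet\rho(f)^{-1}\bullet(f\vartriangleleft\eta_b)$ and $(\mu_a\vartriangleright f)\bullet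 n_f=\alpha^{-1}\bullet(m_a\vartriangleleft n_f)\bullet\alpha\bullet(n_f\vartriangleright m_b)\bullet\alpha^{-1}\bullet(f\vartriangleleft\mu_b)$. 2-cells $(f,n_f)\Rightarrow(g,n_g)$: 2-cells $x:f\Rightarrow g$ with $n_f\bullet(x\vartriangleright m_b)=(m_a\vartriangleleft x)\bullet n_g$. Bicategory of Kleisli triples. Objects: a univalent category $C$ with a function $M_C:C_0\to C_0$, morphisms $\eta(a):a\to M_C(a)$ for each object $a$, and for each $f:a\to M_C(b)$ a morphism $f^*:M_C(a)\to M_C(b)$, such that $\eta(a)^*=\mathrm{id}$, $\eta(a)\cdot f^*=f$, and $f^*\cdot g^*=(f\cdot g^* )^*$. For $h:x\to y$ write $M_C(h):=(h\cdot\eta(y))^*$. 1-cells from $(C,M_C)$ to $(D,M_D)$: a functor $F:C\to D$ with isomorphisms $F_M(a):M_D(F(a))\cong F(M_C(a))$ for each object $a$ of $C$, such that $\eta_D(F(a))\cdot F_M(a)=F(\eta_C(a))$ and, for $f:a\to M_C(b)$, $F_M(a)\cdot F(f^* )=(F(f)\cdot F_M(b)^{-1})^*\cdot F_M(b)$. 2-cells $(F,F_M)\Rightarrow(G,G_M)$: natural transformations $n:F\Rightarrow G$ with $F_M(a)\cdot n(M_C(a))=M_D(n(a))\cdot G_M(a)$ for all $a$. A biequivalence from $\mathsf{B}$ to $\mathsf{C}$ consists of pseudofunctors $L:\mathsf{B}\to\mathsf{C}$ and $R:\mathsf{C}\to\mathsf{B}$; pseudotransformations $\eta:R\cdot L\Rightarrow\mathrm{id}(\mathsf{C})$,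 $\eta_i:\mathrm{id}(\mathsf{C})\Rightarrow R\cdot L$, $\varepsilon:L\cdot R\Rightarrow\mathrm{id}(\mathsf{B})$, $\varepsilon_i:\mathrm{id}(\mathsf{B})\Rightarrow L\cdot R$; and invertible modifications from each of $\eta\bullet\eta_i$, $\eta_i\bullet\eta$, $\varepsilon\bullet\varepsilon_i$, $\varepsilon_i\bullet\varepsilon$ to the respective identity pseudotransformation. *)

(* Defs.v *)
From Stdlib Require Import FunctionalExtensionality.

Set Implicit Arguments.
Unset Strict Implicit.
Unset Printing Implicit Defensive.

(** The identity type is [eq].  It eliminates into [Type], hence it is
    equivalent to a [Type]-valued identity type, and no form of UIP or of
    proof irrelevance is used: sets are required to be sets explicitly. *)

Definition is_set (A : Type) : Prop := forall (x y : A) (p q : x = y), p = q.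

(** A map is an equivalence if its fibres are contractible. *)

Definition is_contr (A : Type) : Type := {c : A & forall x : A, x = c}.

Definition is_equiv (A B : Type) (f : A -> B) : Type :=
  forall b : B, is_contr {a : A & f a = b}.

(** All composites are written in diagrammatic order. *)

Reserved Notation "f · g" (at level 40, left associativity).

Declare Scope hom_scope.
Delimit Scope hom_scope with hom.

Record Category : Type := {
  ob :> Type;
  hom : ob -> ob -> Type;
  idm : forall x, hom x x;
  comp : forall x y z, hom x y -> hom y z -> hom x z
    where "f · g" := (comp f g) : hom_scope;
  hom_is_set : forall x y, is_set (hom x y);
  comp_id_l : forall x y (f : hom x y), idm x · f = f;
  comp_id_r : forall x y (f : hom x y), f · idm y = f;
  comp_assoc : forall w x y z (f : hom w x) (g : hom x y) (h : hom y z),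
    f · (g · h) = (f · g) · h
}.

Arguments hom {_} _ _.
Arguments idm {_} _.
Arguments comp {_ _ _ _} _ _.

Bind Scope hom_scope with hom.
Open Scope hom_scope.
Notation "f · g" := (comp f g) : hom_scope.

Record iso (C : Category) (x y : C) : Type := {
  iso_mor :> hom x y;
  iso_inv : hom y x;
  iso_mor_inv : iso_mor · iso_inv = idm x;
  iso_inv_mor : iso_inv · iso_mor = idm y
}.

Arguments iso {_} _ _.
Arguments iso_mor {_ _ _} _.
Arguments iso_inv {_ _ _} _.

Definition id_iso (C : Category) (x : C) : iso x x :=
  {| iso_mor := idm x;
     iso_inv := idm x;
     iso_mor_inv := comp_id_l (idm x);
     iso_inv_mor := comp_id_l (idm x) |}.

Definition id_to_iso (C : Category) (x y : C) (p : x = y) : iso x y :=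
  match p in _ = z return iso x z with eq_refl => id_iso x end.

Definition is_univalent (C : Category) : Type :=
  forall x y : C, is_equiv (@id_to_iso C x y).

Record UnivCat : Type := {
  univ_cat :> Category;
  univ_cat_is_univalent : is_univalent univ_cat
}.

Record Functor (C D : Category) : Type := {
  fob :> C -> D;
  fmap : forall x y : C, hom x y -> hom (fob x) (fob y);
  fmap_id : forall x : C, fmap (idm x) = idm (fob x);
  fmap_comp : forall (x y z : C) (f : hom x y) (g : hom y z),
    fmap (f · g) = fmap f · fmap g
}.

Arguments fmap {_ _} _ {_ _} _.

Record NatTrans (C D : Category) (F G : Functor C D) : Type := {
  nt :> forall x : C, hom (F x) (G x);
  nt_natural : forall (x y : C) (f : hom x y),
    fmap F f · nt y = nt x · fmap G f
}.

Lemma nat_trans_eq (C D : Category) (F G : Functor C D) (s t : NatTrans F G) :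
  (forall x, s x = t x) -> s = t.
Proof.
  destruct s as [s Hs], t as [t Ht]; simpl; intros H.
  assert (E : s = t) by (apply functional_extensionality_dep; exact H).
  subst t; f_equal.
  do 3 (apply functional_extensionality_dep; intro).
  apply hom_is_set.
Qed.

Lemma nat_trans_is_set (C D : Category) (F G : Functor C D) :
  is_set (NatTrans F G).
Proof.
  intros s t.
  set (tr := fun (p : s = t) => nat_trans_eq
    (fun x => f_equal (fun u : NatTrans F G => u x) p)).
  assert (K : forall p : s = t,
             p = eq_trans (tr p)
                   (eq_sym (nat_trans_eq (fun x : C => eq_refl (t x))))).
  { intro p; unfold tr; clear tr; destruct p; simpl.
    now rewrite eq_trans_sym_inv_r. }
  intros p q.
  rewrite (K p), (K q).
  assert (E : tr p = tr q).
  { unfold tr; f_equal.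
    apply functional_extensionality_dep; intro x; apply hom_is_set. }
  now rewrite E.
Qed.

Definition id_functor (C : Category) : Functor C C :=
  {| fob := fun x => x;
     fmap := fun _ _ f => f;
     fmap_id := fun _ => eq_refl;
     fmap_comp := fun _ _ _ _ _ => eq_refl |}.

Definition comp_functor (C D E : Category) (F : Functor C D) (G : Functor D E) :
  Functor C E.
Proof.
  refine {| fob := fun x => G (F x); fmap := fun _ _ f => fmap G (fmap F f) |}.
  - abstract (intros; now rewrite !fmap_id).
  - abstract (intros; now rewrite !fmap_comp).
Defined.

Definition id_nat (C D : Category) (F : Functor C D) : NatTrans F F.
Proof.
  refine {| nt := fun x => idm (F x) |}.
  abstract (intros; now rewrite comp_id_l, comp_id_r).
Defined.

Definition comp_nat (C D : Category) (F G H : Functor C D)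
  (s : NatTrans F G) (t : NatTrans G H) : NatTrans F H.
Proof.
  refine {| nt := fun x => s x · t x |}.
  abstract (intros; now rewrite comp_assoc, nt_natural,
                        <- comp_assoc, nt_natural, comp_assoc).
Defined.

Definition whisker_l (C D E : Category) (F : Functor C D) (G H : Functor D E)
  (s : NatTrans G H) : NatTrans (comp_functor F G) (comp_functor F H).
Proof.
  refine {| nt := fun x => s (F x) : hom (comp_functor F G x) (comp_functor F H x) |}.
  abstract (intros; simpl; apply (nt_natural s)).
Defined.

Definition whisker_r (C D E : Category) (F G : Functor C D) (H : Functor D E)
  (s : NatTrans F G) : NatTrans (comp_functor F H) (comp_functor G H).
Proof.
  refine {| nt := fun x => fmap H (s x) : hom (comp_functor F H x) (comp_functor G H x) |}.
  abstract (intros; simpl; now rewrite <- !fmap_comp, nt_natural).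
Defined.

Section StructuralNat.
  Local Ltac ids :=
    abstract (intros; simpl; now rewrite comp_id_l, comp_id_r).

  Context (C D : Category) (F : Functor C D).

  Definition lunitor_nat : NatTrans (comp_functor (id_functor C) F) F.
  Proof. refine {| nt := fun x => idm (F x) : hom (comp_functor (id_functor C) F x) (F x) |}; ids. Defined.

  Definition linvunitor_nat : NatTrans F (comp_functor (id_functor C) F).
  Proof. refine {| nt := fun x => idm (F x) : hom (F x) (comp_functor (id_functor C) F x) |}; ids. Defined.

  Definition runitor_nat : NatTrans (comp_functor F (id_functor D)) F.
  Proof. refine {| nt := fun x => idm (F x) : hom (comp_functor F (id_functor D) x) (F x) |}; ids. Defined.

  Definition rinvunitor_nat : NatTrans F (comp_functor F (id_functor D)).
  Proof. refine {| nt := fun x => idm (F x) : hom (F x) (comp_functor F (id_functor D) x) |}; ids. Defined.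

  Context (D' D'' : Category) (G : Functor D D') (H : Functor D' D'').

  Definition lassociator_nat :
    NatTrans (comp_functor F (comp_functor G H)) (comp_functor (comp_functor F G) H).
  Proof.
    refine {| nt := fun x => idm (H (G (F x))) :
      hom (comp_functor F (comp_functor G H) x) (comp_functor (comp_functor F G) H x) |}; ids.
  Defined.

  Definition rassociator_nat :
    NatTrans (comp_functor (comp_functor F G) H) (comp_functor F (comp_functor G H)).
  Proof.
    refine {| nt := fun x => idm (H (G (F x))) :
      hom (comp_functor (comp_functor F G) H x) (comp_functor F (comp_functor G H) x) |}; ids.
  Defined.
End StructuralNat.

Close Scope hom_scope.

Record BicatData : Type := {
  bob :> Type;
  cell1 : bob -> bob -> Type;
  cell2 : forall a b : bob, cell1 a b -> cell1 a b -> Type;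
  id1 : forall a : bob, cell1 a a;
  comp1 : forall a b c : bob, cell1 a b -> cell1 b c -> cell1 a c;
  id2 : forall (a b : bob) (f : cell1 a b), cell2 f f;
  vcomp : forall (a b : bob) (f g h : cell1 a b),
    cell2 f g -> cell2 g h -> cell2 f h;
  lwhisker : forall (a b c : bob) (f : cell1 a b) (g h : cell1 b c),
    cell2 g h -> cell2 (comp1 f g) (comp1 f h);
  rwhisker : forall (a b c : bob) (f g : cell1 a b) (h : cell1 b c),
    cell2 f g -> cell2 (comp1 f h) (comp1 g h);
  lunitor : forall (a b : bob) (f : cell1 a b), cell2 (comp1 (id1 a) f) f;
  linvunitor : forall (a b : bob) (f : cell1 a b), cell2 f (comp1 (id1 a) f);
  runitor : forall (a b : bob) (f : cell1 a b), cell2 (comp1 f (id1 b)) f;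
  rinvunitor : forall (a b : bob) (f : cell1 a b), cell2 f (comp1 f (id1 b));
  lassociator : forall (a b c d : bob)
    (f : cell1 a b) (g : cell1 b c) (h : cell1 c d),
    cell2 (comp1 f (comp1 g h)) (comp1 (comp1 f g) h);
  rassociator : forall (a b c d : bob)
    (f : cell1 a b) (g : cell1 b c) (h : cell1 c d),
    cell2 (comp1 (comp1 f g) h) (comp1 f (comp1 g h))
}.

Arguments cell1 {_} _ _.
Arguments cell2 {_ _ _} _ _.
Arguments id1 {_} _.
Arguments comp1 {_ _ _ _} _ _.
Arguments id2 {_ _ _} _.
Arguments vcomp {_ _ _ _ _ _} _ _.
Arguments lwhisker {_ _ _ _} _ {_ _} _.
Arguments rwhisker {_ _ _ _ _ _} _ _.
Arguments lunitor {_ _ _} _.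
Arguments linvunitor {_ _ _} _.
Arguments runitor {_ _ _} _.
Arguments rinvunitor {_ _ _} _.
Arguments lassociator {_ _ _ _ _} _ _ _.
Arguments rassociator {_ _ _ _ _} _ _ _.

Declare Scope bicat_scope.
Delimit Scope bicat_scope with bicat.
Bind Scope bicat_scope with cell1.
Bind Scope bicat_scope with cell2.
Open Scope bicat_scope.

Notation "f · g" := (comp1 f g) : bicat_scope.
Notation "f ==> g" := (cell2 f g) (at level 70, no associativity) : bicat_scope.
Notation "x • y" := (vcomp x y) (at level 60, right associativity) : bicat_scope.
Notation "f ◁ x" := (lwhisker f x) (at level 50, left associativity) : bicat_scope.
Notation "x ▷ g" := (rwhisker g x) (at level 50, left associativity) : bicat_scope.

Record BicatLaws (B : BicatData) : Prop := {
  cell2_is_set : forall (a b : B) (f g : cell1 a b), is_set (f ==> g);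
  id2_l : forall (a b : B) (f g : cell1 a b) (x : f ==> g), id2 f • x = x;
  id2_r : forall (a b : B) (f g : cell1 a b) (x : f ==> g), x • id2 g = x;
  vassoc : forall (a b : B) (f g h k : cell1 a b)
    (x : f ==> g) (y : g ==> h) (z : h ==> k), (x • y) • z = x • (y • z);
  lwhisker_id2 : forall (a b c : B) (f : cell1 a b) (g : cell1 b c),
    f ◁ id2 g = id2 (f · g);
  rwhisker_id2 : forall (a b c : B) (f : cell1 a b) (g : cell1 b c),
    id2 f ▷ g = id2 (f · g);
  lwhisker_vcomp : forall (a b c : B) (f : cell1 a b) (g h k : cell1 b c)
    (x : g ==> h) (y : h ==> k), f ◁ (x • y) = (f ◁ x) • (f ◁ y);
  rwhisker_vcomp : forall (a b c : B) (f g h : cell1 a b) (k : cell1 b c)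
    (x : f ==> g) (y : g ==> h), (x • y) ▷ k = (x ▷ k) • (y ▷ k);
  lunitor_natural : forall (a b : B) (f g : cell1 a b) (x : f ==> g),
    (id1 a ◁ x) • lunitor g = lunitor f • x;
  runitor_natural : forall (a b : B) (f g : cell1 a b) (x : f ==> g),
    (x ▷ id1 b) • runitor g = runitor f • x;
  lwhisker_lwhisker : forall (a b c d : B) (f : cell1 a b) (g : cell1 b c)
    (h k : cell1 c d) (x : h ==> k),
    (f ◁ (g ◁ x)) • lassociator f g k = lassociator f g h • (f · g ◁ x);
  rwhisker_lwhisker : forall (a b c d : B) (f : cell1 a b) (g h : cell1 b c)
    (k : cell1 c d) (x : g ==> h),
    (f ◁ (x ▷ k)) • lassociator f h k = lassociator f g k • ((f ◁ x) ▷ k);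
  rwhisker_rwhisker : forall (a b c d : B) (f g : cell1 a b) (h : cell1 b c)
    (k : cell1 c d) (x : f ==> g),
    lassociator f h k • ((x ▷ h) ▷ k) = (x ▷ h · k) • lassociator g h k;
  vcomp_whisker : forall (a b c : B) (f g : cell1 a b) (h k : cell1 b c)
    (x : f ==> g) (y : h ==> k),
    (x ▷ h) • (g ◁ y) = (f ◁ y) • (x ▷ k);
  lunitor_linvunitor : forall (a b : B) (f : cell1 a b),
    lunitor f • linvunitor f = id2 (id1 a · f);
  linvunitor_lunitor : forall (a b : B) (f : cell1 a b),
    linvunitor f • lunitor f = id2 f;
  runitor_rinvunitor : forall (a b : B) (f : cell1 a b),
    runitor f • rinvunitor f = id2 (f · id1 b);
  rinvunitor_runitor : forall (a b : B) (f : cell1 a b),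
    rinvunitor f • runitor f = id2 f;
  lassociator_rassociator : forall (a b c d : B)
    (f : cell1 a b) (g : cell1 b c) (h : cell1 c d),
    lassociator f g h • rassociator f g h = id2 (f · (g · h));
  rassociator_lassociator : forall (a b c d : B)
    (f : cell1 a b) (g : cell1 b c) (h : cell1 c d),
    rassociator f g h • lassociator f g h = id2 (f · g · h);
  triangle : forall (a b c : B) (f : cell1 a b) (g : cell1 b c),
    lassociator f (id1 b) g • (runitor f ▷ g) = f ◁ lunitor g;
  pentagon : forall (a b c d e : B) (f : cell1 a b) (g : cell1 b c)
    (h : cell1 c d) (k : cell1 d e),
    (f ◁ lassociator g h k) • lassociator f (g · h) k • (lassociator f g h ▷ k)
    = lassociator f g (h · k) • lassociator (f · g) h k
}.

Record Bicat : Type := {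
  bicat_data :> BicatData;
  bicat_laws : BicatLaws bicat_data
}.

Record is_inv2 (B : BicatData) (a b : B) (f g : cell1 a b) (x : f ==> g) : Type := {
  inv2 : g ==> f;
  vcomp_inv2 : x • inv2 = id2 f;
  inv2_vcomp : inv2 • x = id2 g
}.

Definition cat_bicat_data : BicatData := {|
  bob := UnivCat;
  cell1 := fun C D => Functor C D;
  cell2 := fun C D F G => NatTrans F G;
  id1 := fun C => id_functor C;
  comp1 := fun C D E F G => comp_functor F G;
  id2 := fun C D F => id_nat F;
  vcomp := fun C D F G H s t => comp_nat s t;
  lwhisker := fun C D E F G H s => whisker_l F s;
  rwhisker := fun C D E F G H s => whisker_r H s;
  lunitor := fun C D F => lunitor_nat F;
  linvunitor := fun C D F => linvunitor_nat F;
  runitor := fun C D F => runitor_nat F;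
  rinvunitor := fun C D F => rinvunitor_nat F;
  lassociator := fun C1 C2 C3 C4 F G H => lassociator_nat F G H;
  rassociator := fun C1 C2 C3 C4 F G H => rassociator_nat F G H
|}.

Lemma cat_bicat_laws : BicatLaws cat_bicat_data.
Proof.
  split; try (intros; apply nat_trans_is_set);
    simpl; intros; apply nat_trans_eq; intro; simpl;
    rewrite ?fmap_id, ?fmap_comp, ?comp_id_l, ?comp_id_r;
    rewrite ?comp_assoc, ?comp_id_l, ?comp_id_r; try reflexivity.
  all: first [ apply nt_natural | symmetry; apply nt_natural ].
Qed.

Definition Cat : Bicat :=
  {| bicat_data := cat_bicat_data; bicat_laws := cat_bicat_laws |}.

(** To prove an equation between 2-cells, it suffices to prove it after
    whiskering on the left with an arbitrary 1-cell [h].  The lemmas [strict_*]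
    push [h ◁ _] inwards, which brackets composites of 1-cells to the left;
    then the structural cells cancel.  The tactic [strictify] does both. *)

Section Coherence.
  Context {B : Bicat}.

  Lemma vcomp_pre (a b : B) (f g h k : cell1 a b)
    (x : f ==> g) (y : g ==> h) (w : f ==> h) :
    x • y = w -> forall z : h ==> k, x • y • z = w • z.
  Proof. intros <- z; symmetry; apply (vassoc (bicat_laws B)). Qed.

  Lemma cancel_r (a b : B) (f g h : cell1 a b) (x y : f ==> g) (z : g ==> h) :
    is_inv2 z -> x • z = y • z -> x = y.
  Proof.
    intros [z' Hz _] E.
    rewrite <- (id2_r (bicat_laws B) x), <- (id2_r (bicat_laws B) y), <- Hz.
    rewrite <- !(vassoc (bicat_laws B)); now rewrite E.
  Qed.

  Lemma cancel_l (a b : B) (f g h : cell1 a b) (x : f ==> g) (y z : g ==> h) :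
    is_inv2 x -> x • y = x • z -> y = z.
  Proof.
    intros [x' _ Hx] E.
    rewrite <- (id2_l (bicat_laws B) y), <- (id2_l (bicat_laws B) z), <- Hx.
    rewrite !(vassoc (bicat_laws B)); now rewrite E.
  Qed.

  Definition is_inv2_lassociator (a b c d : B)
    (f : cell1 a b) (g : cell1 b c) (h : cell1 c d) : is_inv2 (lassociator f g h) :=
    {| inv2 := rassociator f g h;
       vcomp_inv2 := lassociator_rassociator (bicat_laws B) f g h;
       inv2_vcomp := rassociator_lassociator (bicat_laws B) f g h |}.

  Definition is_inv2_rassociator (a b c d : B)
    (f : cell1 a b) (g : cell1 b c) (h : cell1 c d) : is_inv2 (rassociator f g h) :=
    {| inv2 := lassociator f g h;
       vcomp_inv2 := rassociator_lassociator (bicat_laws B) f g h;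
       inv2_vcomp := lassociator_rassociator (bicat_laws B) f g h |}.

  Definition is_inv2_lunitor (a b : B) (f : cell1 a b) : is_inv2 (lunitor f) :=
    {| inv2 := linvunitor f;
       vcomp_inv2 := lunitor_linvunitor (bicat_laws B) f;
       inv2_vcomp := linvunitor_lunitor (bicat_laws B) f |}.

  Definition is_inv2_linvunitor (a b : B) (f : cell1 a b) : is_inv2 (linvunitor f) :=
    {| inv2 := lunitor f;
       vcomp_inv2 := linvunitor_lunitor (bicat_laws B) f;
       inv2_vcomp := lunitor_linvunitor (bicat_laws B) f |}.

  Definition is_inv2_runitor (a b : B) (f : cell1 a b) : is_inv2 (runitor f) :=
    {| inv2 := rinvunitor f;
       vcomp_inv2 := runitor_rinvunitor (bicat_laws B) f;
       inv2_vcomp := rinvunitor_runitor (bicat_laws B) f |}.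

  Definition is_inv2_rinvunitor (a b : B) (f : cell1 a b) : is_inv2 (rinvunitor f) :=
    {| inv2 := runitor f;
       vcomp_inv2 := rinvunitor_runitor (bicat_laws B) f;
       inv2_vcomp := runitor_rinvunitor (bicat_laws B) f |}.

  Definition is_inv2_id2 (a b : B) (f : cell1 a b) : is_inv2 (id2 f) :=
    {| inv2 := id2 f;
       vcomp_inv2 := id2_l (bicat_laws B) (id2 f);
       inv2_vcomp := id2_l (bicat_laws B) (id2 f) |}.

  Definition is_inv2_vcomp (a b : B) (f g h : cell1 a b) (x : f ==> g) (y : g ==> h)
    (Hx : is_inv2 x) (Hy : is_inv2 y) : is_inv2 (x • y).
  Proof.
    exists (inv2 Hy • inv2 Hx).
    - abstract (rewrite (vassoc (bicat_laws B)), (vcomp_pre (vcomp_inv2 Hy));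
                now rewrite (id2_l (bicat_laws B)), vcomp_inv2).
    - abstract (rewrite (vassoc (bicat_laws B)), (vcomp_pre (inv2_vcomp Hx));
                now rewrite (id2_l (bicat_laws B)), inv2_vcomp).
  Defined.

  Definition is_inv2_lwhisker (a b c : B) (f : cell1 a b) (g h : cell1 b c)
    (x : g ==> h) (Hx : is_inv2 x) : is_inv2 (f ◁ x).
  Proof.
    exists (f ◁ inv2 Hx).
    - abstract (now rewrite <- (lwhisker_vcomp (bicat_laws B)), vcomp_inv2,
                  (lwhisker_id2 (bicat_laws B))).
    - abstract (now rewrite <- (lwhisker_vcomp (bicat_laws B)), inv2_vcomp,
                  (lwhisker_id2 (bicat_laws B))).
  Defined.

  Definition is_inv2_rwhisker (a b c : B) (f g : cell1 a b) (h : cell1 b c)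
    (x : f ==> g) (Hx : is_inv2 x) : is_inv2 (x ▷ h).
  Proof.
    exists (inv2 Hx ▷ h).
    - abstract (now rewrite <- (rwhisker_vcomp (bicat_laws B)), vcomp_inv2,
                  (rwhisker_id2 (bicat_laws B))).
    - abstract (now rewrite <- (rwhisker_vcomp (bicat_laws B)), inv2_vcomp,
                  (rwhisker_id2 (bicat_laws B))).
  Defined.

  Lemma lwhisker_id_inj (a b : B) (f g : cell1 a b) (x y : f ==> g) :
    id1 a ◁ x = id1 a ◁ y -> x = y.
  Proof.
    intros E; apply (cancel_l (is_inv2_lunitor f)).
    now rewrite <- !(lunitor_natural (bicat_laws B)), E.
  Qed.

  Lemma rwhisker_id_inj (a b : B) (f g : cell1 a b) (x y : f ==> g) :
    x ▷ id1 b = y ▷ id1 b -> x = y.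
  Proof.
    intros E; apply (cancel_l (is_inv2_runitor f)).
    now rewrite <- !(runitor_natural (bicat_laws B)), E.
  Qed.

  Lemma lwhisker_inj (a b : B) (f g : cell1 a b) (x y : f ==> g) :
    (forall (c : B) (h : cell1 c a), h ◁ x = h ◁ y) -> x = y.
  Proof. intros E; apply lwhisker_id_inj, E. Qed.

  Lemma pentagon_pre (a b c d e : B) (f : cell1 a b) (g : cell1 b c)
    (h : cell1 c d) (k : cell1 d e) (l : cell1 a e) (z : (f · (g · h)) · k ==> l)
    (z' : ((f · g) · h) · k ==> l) :
    (lassociator f g h ▷ k) • z' = z ->
    (f ◁ lassociator g h k) • lassociator f (g · h) k • z
    = lassociator f g (h · k) • lassociator (f · g) h k • z'.
  Proof.
    intros <-.
    pose proof (f_equal (fun x => x • z') (pentagon (bicat_laws B) f g h k)) as E.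
    cbv beta in E; now rewrite !(vassoc (bicat_laws B)) in E.
  Qed.

  Lemma lwhisker_runitor (a b c : B) (f : cell1 a b) (g : cell1 b c) :
    f ◁ runitor g = lassociator f g (id1 c) • runitor (f · g).
  Proof.
    apply rwhisker_id_inj.
    apply (cancel_l (is_inv2_lassociator _ _ _)).
    apply (cancel_l (is_inv2_lwhisker f (is_inv2_lassociator g (id1 c) (id1 c)))).
    rewrite (pentagon_pre (eq_sym (rwhisker_vcomp (bicat_laws B) _ _ _))).
    rewrite (triangle (bicat_laws B)).
    rewrite <- (lwhisker_lwhisker (bicat_laws B)), <- (triangle (bicat_laws B)).
    rewrite (lwhisker_vcomp (bicat_laws B)), (vassoc (bicat_laws B)).
    now rewrite (rwhisker_lwhisker (bicat_laws B)).
  Qed.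

  Lemma lunitor_comp1 (a b c : B) (f : cell1 a b) (g : cell1 b c) :
    lunitor (f · g) = lassociator (id1 a) f g • (lunitor f ▷ g).
  Proof.
    apply lwhisker_id_inj.
    apply (cancel_r (is_inv2_lassociator (id1 a) f g)).
    rewrite (lwhisker_vcomp (bicat_laws B)), (vassoc (bicat_laws B)).
    rewrite (rwhisker_lwhisker (bicat_laws B)), <- !(triangle (bicat_laws B)).
    rewrite (pentagon_pre (eq_sym (rwhisker_vcomp (bicat_laws B) _ _ _))).
    now rewrite (rwhisker_rwhisker (bicat_laws B)), ?(vassoc (bicat_laws B)).
  Qed.

  Lemma lunitor_id1 (a : B) : lunitor (id1 a) = runitor (id1 a).
  Proof.
    apply lwhisker_id_inj.
    rewrite <- (triangle (bicat_laws B)), lwhisker_runitor.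
    f_equal.
    apply (cancel_r (is_inv2_runitor (id1 a))).
    now rewrite (runitor_natural (bicat_laws B)).
  Qed.

  Lemma linvunitor_id1 (a : B) : linvunitor (id1 a) = rinvunitor (id1 a).
  Proof.
    apply (cancel_r (is_inv2_lunitor (id1 a))).
    rewrite (linvunitor_lunitor (bicat_laws B)), lunitor_id1.
    now rewrite (rinvunitor_runitor (bicat_laws B)).
  Qed.

  Lemma move_r (a b : B) (f g h : cell1 a b) (x : f ==> g) (y : g ==> h) (w : f ==> h)
    (Hy : is_inv2 y) : x • y = w -> x = w • inv2 Hy.
  Proof.
    intros <-; rewrite (vassoc (bicat_laws B)), vcomp_inv2.
    symmetry; apply (id2_r (bicat_laws B)).
  Qed.

  Lemma move_l (a b : B) (f g h : cell1 a b) (x : f ==> g) (y : g ==> h) (w : f ==> h)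
    (Hx : is_inv2 x) : x • y = w -> y = inv2 Hx • w.
  Proof.
    intros <-; rewrite <- (vassoc (bicat_laws B)), inv2_vcomp.
    symmetry; apply (id2_l (bicat_laws B)).
  Qed.

  Lemma inv2_unique (a b : B) (f g : cell1 a b) (x : f ==> g) (Hx : is_inv2 x)
    (y : g ==> f) : x • y = id2 f -> y = inv2 Hx.
  Proof. intros E; rewrite (move_l Hx E); apply (id2_r (bicat_laws B)). Qed.

  Lemma rwhisker_ru_riu (a b c : B) (f : cell1 a b) (k : cell1 b c) :
    (runitor f ▷ k) • (rinvunitor f ▷ k) = id2 _.
  Proof. apply (vcomp_inv2 (is_inv2_rwhisker k (is_inv2_runitor f))). Qed.

  Lemma rwhisker_lu_liu (a b c : B) (f : cell1 a b) (k : cell1 b c) :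
    (lunitor f ▷ k) • (linvunitor f ▷ k) = id2 _.
  Proof. apply (vcomp_inv2 (is_inv2_rwhisker k (is_inv2_lunitor f))). Qed.

  Lemma strict_lwhisker (a b c d : B) (h : cell1 a b) (f : cell1 b c)
    (g k : cell1 c d) (x : g ==> k) :
    h ◁ (f ◁ x) = lassociator h f g • (h · f ◁ x) • rassociator h f k.
  Proof.
    rewrite (move_r (is_inv2_lassociator _ _ _) (lwhisker_lwhisker (bicat_laws B) h f x)).
    apply (vassoc (bicat_laws B)).
  Qed.

  Lemma strict_rwhisker (a b c d : B) (h : cell1 a b) (f g : cell1 b c)
    (k : cell1 c d) (x : f ==> g) :
    h ◁ (x ▷ k) = lassociator h f k • (h ◁ x ▷ k) • rassociator h g k.
  Proof.
    rewrite (move_r (is_inv2_lassociator _ _ _) (rwhisker_lwhisker (bicat_laws B) h k x)).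
    apply (vassoc (bicat_laws B)).
  Qed.

  Lemma strict_rwhisker_comp1 (a b c d : B) (f g : cell1 a b) (h : cell1 b c)
    (k : cell1 c d) (x : f ==> g) :
    x ▷ h · k = lassociator f h k • (x ▷ h ▷ k) • rassociator g h k.
  Proof.
    rewrite (move_r (is_inv2_lassociator _ _ _)
               (eq_sym (rwhisker_rwhisker (bicat_laws B) h k x))).
    apply (vassoc (bicat_laws B)).
  Qed.

  Lemma strict_lassociator (a b c d e : B) (h : cell1 a b) (f : cell1 b c)
    (g : cell1 c d) (k : cell1 d e) :
    h ◁ lassociator f g k =
    lassociator h f (g · k) • lassociator (h · f) g k •
    (rassociator h f g ▷ k) • rassociator h (f · g) k.
  Proof.
    pose proof (pentagon (bicat_laws B) h f g k) as E.
    rewrite <- !(vassoc (bicat_laws B)) in E |- *.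
    apply (move_r (is_inv2_rwhisker k (is_inv2_lassociator h f g))) in E.
    apply (move_r (is_inv2_lassociator h (f · g) k)) in E.
    rewrite E, !(vassoc (bicat_laws B)); reflexivity.
  Qed.

  Lemma strict_rassociator (a b c d e : B) (h : cell1 a b) (f : cell1 b c)
    (g : cell1 c d) (k : cell1 d e) :
    h ◁ rassociator f g k =
    lassociator h (f · g) k • (lassociator h f g ▷ k) •
    rassociator (h · f) g k • rassociator h f (g · k).
  Proof.
    rewrite <- !(vassoc (bicat_laws B)).
    apply (cancel_l (is_inv2_lwhisker h (is_inv2_lassociator f g k))).
    transitivity (id2 (h · (f · (g · k)))).
    { apply (vcomp_inv2 (is_inv2_lwhisker h (is_inv2_lassociator f g k))). }
    rewrite !(vassoc (bicat_laws B)).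
    rewrite (pentagon_pre (z' := rassociator (h · f) g k • rassociator h f (g · k)) eq_refl).
    rewrite (vcomp_pre (lassociator_rassociator (bicat_laws B) (h · f) g k)).
    rewrite (id2_l (bicat_laws B)).
    symmetry; apply (lassociator_rassociator (bicat_laws B)).
  Qed.

  Lemma strict_lunitor (a b c : B) (h : cell1 a b) (f : cell1 b c) :
    h ◁ lunitor f = lassociator h (id1 b) f • (runitor h ▷ f).
  Proof. symmetry; apply (triangle (bicat_laws B)). Qed.

  Lemma strict_linvunitor (a b c : B) (h : cell1 a b) (f : cell1 b c) :
    h ◁ linvunitor f = (rinvunitor h ▷ f) • rassociator h (id1 b) f.
  Proof.
    symmetry.
    apply (inv2_unique (is_inv2_lwhisker h (is_inv2_lunitor f))).
    rewrite <- (triangle (bicat_laws B)), (vassoc (bicat_laws B)).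
    rewrite (vcomp_pre (rwhisker_ru_riu h f)).
    rewrite (id2_l (bicat_laws B)).
    apply (lassociator_rassociator (bicat_laws B)).
  Qed.

  Lemma strict_rinvunitor (a b c : B) (h : cell1 a b) (f : cell1 b c) :
    h ◁ rinvunitor f = rinvunitor (h · f) • rassociator h f (id1 c).
  Proof.
    symmetry.
    apply (inv2_unique (is_inv2_lwhisker h (is_inv2_runitor f))).
    rewrite lwhisker_runitor, (vassoc (bicat_laws B)).
    rewrite (vcomp_pre (runitor_rinvunitor (bicat_laws B) (h · f))).
    rewrite (id2_l (bicat_laws B)).
    apply (lassociator_rassociator (bicat_laws B)).
  Qed.

  Lemma linvunitor_comp1 (a b c : B) (f : cell1 a b) (g : cell1 b c) :
    linvunitor (f · g) = (linvunitor f ▷ g) • rassociator (id1 a) f g.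
  Proof.
    symmetry; apply (inv2_unique (is_inv2_lunitor (f · g))).
    rewrite lunitor_comp1, (vassoc (bicat_laws B)).
    rewrite (vcomp_pre (rwhisker_lu_liu f g)).
    rewrite (id2_l (bicat_laws B)).
    apply (lassociator_rassociator (bicat_laws B)).
  Qed.

  Lemma rinvunitor_natural (a b : B) (f g : cell1 a b) (x : f ==> g) :
    rinvunitor f • (x ▷ id1 b) = x • rinvunitor g.
  Proof.
    apply (cancel_r (is_inv2_runitor g)).
    rewrite !(vassoc (bicat_laws B)), (runitor_natural (bicat_laws B)).
    rewrite (rinvunitor_runitor (bicat_laws B)), (id2_r (bicat_laws B)).
    rewrite (vcomp_pre (rinvunitor_runitor (bicat_laws B) f)).
    apply (id2_l (bicat_laws B)).
  Qed.

  Definition la_ra (a b c d : B) (f : cell1 a b) (g : cell1 b c) (h : cell1 c d) :=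
    lassociator_rassociator (bicat_laws B) f g h.
  Definition ra_la (a b c d : B) (f : cell1 a b) (g : cell1 b c) (h : cell1 c d) :=
    rassociator_lassociator (bicat_laws B) f g h.
  Definition ru_riu (a b : B) (f : cell1 a b) := runitor_rinvunitor (bicat_laws B) f.
  Definition riu_ru (a b : B) (f : cell1 a b) := rinvunitor_runitor (bicat_laws B) f.
  Definition id2l (a b : B) (f g : cell1 a b) (x : f ==> g) := id2_l (bicat_laws B) x.
  Definition id2r (a b : B) (f g : cell1 a b) (x : f ==> g) := id2_r (bicat_laws B) x.
  Definition vass (a b : B) (f g h k : cell1 a b)
    (x : f ==> g) (y : g ==> h) (z : h ==> k) := vassoc (bicat_laws B) x y z.
  Definition lw_id2 (a b c : B) (f : cell1 a b) (g : cell1 b c) :=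
    lwhisker_id2 (bicat_laws B) f g.
  Definition rw_id2 (a b c : B) (f : cell1 a b) (g : cell1 b c) :=
    rwhisker_id2 (bicat_laws B) f g.
  Definition lw_vcomp (a b c : B) (f : cell1 a b) (g h k : cell1 b c)
    (x : g ==> h) (y : h ==> k) := lwhisker_vcomp (bicat_laws B) f x y.
  Definition rw_vcomp (a b c : B) (f g h : cell1 a b) (k : cell1 b c)
    (x : f ==> g) (y : g ==> h) := rwhisker_vcomp (bicat_laws B) k x y.

  Lemma rw_cancel (a b c : B) (f g : cell1 a b) (k : cell1 b c)
    (x : f ==> g) (y : g ==> f) : x • y = id2 f -> (x ▷ k) • (y ▷ k) = id2 (f · k).
  Proof. intros E; rewrite <- rw_vcomp, E; apply rw_id2. Qed.

  Lemma lw_cancel (a b c : B) (k : cell1 a b) (f g : cell1 b c)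
    (x : f ==> g) (y : g ==> f) : x • y = id2 f -> (k ◁ x) • (k ◁ y) = id2 (k · f).
  Proof. intros E; rewrite <- lw_vcomp, E; apply lw_id2. Qed.

  Lemma law_iff (a b : B) (f g : cell1 a b) (x y : f ==> g)
    (f' g' : forall c (h : cell1 c a), cell1 c b)
    (p : forall c (h : cell1 c a), h · f ==> f' c h)
    (q : forall c (h : cell1 c a), g' c h ==> h · g)
    (x' y' : forall c (h : cell1 c a), f' c h ==> g' c h) :
    (forall c h, is_inv2 (p c h)) -> (forall c h, is_inv2 (q c h)) ->
    (forall c h, h ◁ x = p c h • x' c h • q c h) ->
    (forall c h, h ◁ y = p c h • y' c h • q c h) ->
    x = y <-> forall c h, x' c h = y' c h.
  Proof.
    intros Hp Hq Hx Hy; split.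
    - intros E c h; apply (cancel_r (Hq c h)), (cancel_l (Hp c h)).
      now rewrite <- Hx, <- Hy, E.
    - intros E; apply lwhisker_inj; intros; now rewrite Hx, Hy, E.
  Qed.
End Coherence.

Ltac push_step :=
  match goal with
  | |- context [(?x • ?y) • ?z] => rewrite (vass x y z)
  | |- context [?h ◁ (?x • ?y)] => rewrite (lw_vcomp h x y)
  | |- context [(?x • ?y) ▷ ?h] => rewrite (rw_vcomp h x y)
  | |- context [?h ◁ (?f ◁ ?x)] => rewrite (strict_lwhisker h f x)
  | |- context [?h ◁ (?x ▷ ?k)] => rewrite (strict_rwhisker h k x)
  | |- context [?x ▷ (?h · ?k)] => rewrite (strict_rwhisker_comp1 h k x)
  | |- context [?h ◁ lassociator ?f ?g ?k] => rewrite (strict_lassociator h f g k)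
  | |- context [?h ◁ rassociator ?f ?g ?k] => rewrite (strict_rassociator h f g k)
  | |- context [?h ◁ lunitor ?f] => rewrite (strict_lunitor h f)
  | |- context [?h ◁ linvunitor ?f] => rewrite (strict_linvunitor h f)
  | |- context [?h ◁ runitor ?f] => rewrite (lwhisker_runitor h f)
  | |- context [?h ◁ rinvunitor ?f] => rewrite (strict_rinvunitor h f)
  | |- context [lunitor (?f · ?g)] => rewrite (lunitor_comp1 f g)
  | |- context [linvunitor (?f · ?g)] => rewrite (linvunitor_comp1 f g)
  | |- context [lunitor (id1 ?a)] => rewrite (lunitor_id1 a)
  | |- context [linvunitor (id1 ?a)] => rewrite (linvunitor_id1 a)
  | |- context [?h ◁ id2 ?f] => rewrite (lw_id2 h f)
  | |- context [id2 ?f ▷ ?h] => rewrite (rw_id2 f h)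
  | |- context [id2 _ • ?x] => rewrite (id2l x)
  | |- context [?x • id2 _] => rewrite (id2r x)
  end.

Ltac inv_pair :=
  first [ apply la_ra | apply ra_la | apply ru_riu | apply riu_ru
        | apply rw_cancel; inv_pair ].

Ltac cancel_step :=
  match goal with
  | |- context [lassociator ?f ?g ?h • rassociator ?f ?g ?h • ?z] =>
      rewrite (vcomp_pre (la_ra f g h) z), (id2l z)
  | |- context [rassociator ?f ?g ?h • lassociator ?f ?g ?h • ?z] =>
      rewrite (vcomp_pre (ra_la f g h) z), (id2l z)
  | |- context [runitor ?f • rinvunitor ?f • ?z] =>
      rewrite (vcomp_pre (ru_riu f) z), (id2l z)
  | |- context [rinvunitor ?f • runitor ?f • ?z] =>
      rewrite (vcomp_pre (riu_ru f) z), (id2l z)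
  | |- context [?x ▷ ?k • ?y ▷ ?k • ?z] =>
      let E := fresh in
      assert (E : (x ▷ k) • (y ▷ k) = id2 _) by (apply rw_cancel; inv_pair);
      rewrite (vcomp_pre E z), (id2l z); clear E
  | |- context [lassociator ?f ?g ?h • rassociator ?f ?g ?h] => rewrite (la_ra f g h)
  | |- context [rassociator ?f ?g ?h • lassociator ?f ?g ?h] => rewrite (ra_la f g h)
  | |- context [runitor ?f • rinvunitor ?f] => rewrite (ru_riu f)
  | |- context [rinvunitor ?f • runitor ?f] => rewrite (riu_ru f)
  | |- context [?x ▷ ?k • ?y ▷ ?k] =>
      let E := fresh in
      assert (E : (x ▷ k) • (y ▷ k) = id2 _) by (apply rw_cancel; inv_pair);
      rewrite E; clear E
  | |- context [id2 _ • ?x] => rewrite (id2l x)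
  | |- context [?x • id2 _] => rewrite (id2r x)
  end.

Ltac strictify := repeat push_step; repeat cancel_step.

(** A 2-cell whose source or target is a composite, whiskered with [h] and
    conjugated with structural cells so that all 1-cells are bracketed to the
    left.  In this form the laws of monad morphisms and of
    pseudotransformations contain no structural cells. *)

Section Strictified.
  Context {B : Bicat}.

  Definition st_unit (a : B) (f : cell1 a a) (x : id1 a ==> f)
    (c : B) (h : cell1 c a) : h ==> h · f :=
    rinvunitor h • (h ◁ x).

  Definition st_mult (a1 a2 a3 : B) (f : cell1 a1 a2) (g : cell1 a2 a3)
    (k : cell1 a1 a3) (x : f · g ==> k) (c : B) (h : cell1 c a1) : h · f · g ==> h · k :=
    rassociator h f g • (h ◁ x).

  Definition st_sq (a b a' b' : B) (f : cell1 a b) (f' : cell1 a' b')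
    (s : cell1 a a') (t : cell1 b b') (x : s · f' ==> f · t)
    (c : B) (h : cell1 c a) : h · s · f' ==> h · f · t :=
    rassociator h s f' • (h ◁ x) • lassociator h f t.

  Lemma st_unit_natural (a : B) (f : cell1 a a) (x : id1 a ==> f)
    (c : B) (h k : cell1 c a) (y : h ==> k) :
    y • st_unit x k = st_unit x h • (y ▷ f).
  Proof.
    unfold st_unit; rewrite vass.
    rewrite <- (vcomp_whisker (bicat_laws B) y x).
    now rewrite (vcomp_pre (rinvunitor_natural y)), vass.
  Qed.

  Lemma st_mult_natural (a1 a2 a3 : B) (f : cell1 a1 a2) (g : cell1 a2 a3)
    (k : cell1 a1 a3) (x : f · g ==> k) (c : B) (h h' : cell1 c a1) (y : h ==> h') :
    (y ▷ f ▷ g) • st_mult x h' = st_mult x h • (y ▷ k).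
  Proof.
    unfold st_mult.
    apply (cancel_l (is_inv2_lassociator _ _ _)).
    pose proof (vcomp_whisker (bicat_laws B) y x) as E; revert E.
    now strictify.
  Qed.

  Lemma st_sq_natural (a b a' b' : B) (f : cell1 a b) (f' : cell1 a' b')
    (s : cell1 a a') (t : cell1 b b') (x : s · f' ==> f · t)
    (c : B) (h k : cell1 c a) (y : h ==> k) :
    (y ▷ s ▷ f') • st_sq x k = st_sq x h • (y ▷ f ▷ t).
  Proof.
    unfold st_sq.
    apply (cancel_l (is_inv2_lassociator _ _ _)).
    apply (cancel_r (is_inv2_rassociator _ _ _)).
    pose proof (vcomp_whisker (bicat_laws B) y x) as E; revert E.
    now strictify.
  Qed.
End Strictified.

Record Monad (B : BicatData) : Type := {
  mnd_ob :> B;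
  mnd_endo : cell1 mnd_ob mnd_ob;
  mnd_unit : id1 mnd_ob ==> mnd_endo;
  mnd_mult : mnd_endo · mnd_endo ==> mnd_endo;
  mnd_unit_r : (mnd_endo ◁ mnd_unit) • mnd_mult = runitor mnd_endo;
  mnd_unit_l : (mnd_unit ▷ mnd_endo) • mnd_mult = lunitor mnd_endo;
  mnd_assoc : (mnd_endo ◁ mnd_mult) • mnd_mult
    = lassociator mnd_endo mnd_endo mnd_endo • (mnd_mult ▷ mnd_endo) • mnd_mult
}.

Arguments mnd_endo {_} _.
Arguments mnd_unit {_} _.
Arguments mnd_mult {_} _.

Definition mnd_mor_unit_law (B : BicatData) (S T : Monad B) (f : cell1 S T)
  (n : mnd_endo S · f ==> f · mnd_endo T) : Prop :=
  (mnd_unit S ▷ f) • n = lunitor f • rinvunitor f • (f ◁ mnd_unit T).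

Definition mnd_mor_mult_law (B : BicatData) (S T : Monad B) (f : cell1 S T)
  (n : mnd_endo S · f ==> f · mnd_endo T) : Prop :=
  (mnd_mult S ▷ f) • n
  = rassociator (mnd_endo S) (mnd_endo S) f
    • (mnd_endo S ◁ n)
    • lassociator (mnd_endo S) f (mnd_endo T)
    • (n ▷ mnd_endo T)
    • rassociator f (mnd_endo T) (mnd_endo T)
    • (f ◁ mnd_mult T).

Record MonadMor (B : BicatData) (S T : Monad B) : Type := {
  mnd_mor_cell1 :> cell1 S T;
  mnd_mor_cell2 : mnd_endo S · mnd_mor_cell1 ==> mnd_mor_cell1 · mnd_endo T;
  mnd_mor_is_inv2 : is_inv2 mnd_mor_cell2;
  mnd_mor_unit : mnd_mor_unit_law mnd_mor_cell2;
  mnd_mor_mult : mnd_mor_mult_law mnd_mor_cell2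
}.

Arguments mnd_mor_cell2 {_ _ _} _.

Record MonadCell (B : BicatData) (S T : Monad B) (f g : MonadMor S T) : Type := {
  mnd_cell :> cell2 (mnd_mor_cell1 f) (mnd_mor_cell1 g);
  mnd_cell_law :
    mnd_mor_cell2 f • (mnd_cell ▷ mnd_endo T)
    = (mnd_endo S ◁ mnd_cell) • mnd_mor_cell2 g
}.

Section MonadBicat.
  Context (B : Bicat).

  Lemma mnd_cell_eq (S T : Monad B) (f g : MonadMor S T) (x y : MonadCell f g) :
    mnd_cell x = mnd_cell y -> x = y.
  Proof.
    destruct x as [x Hx], y as [y Hy]; simpl; intros ->.
    f_equal; apply (cell2_is_set (bicat_laws B)).
  Qed.

  Lemma mnd_cell_is_set (S T : Monad B) (f g : MonadMor S T) :
    is_set (MonadCell f g).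
  Proof.
    intros x y.
    set (tr := fun p : x = y => mnd_cell_eq (f_equal (@mnd_cell _ _ _ _ _) p)).
    assert (K : forall p : x = y,
               p = eq_trans (tr p) (eq_sym (mnd_cell_eq (eq_refl (mnd_cell y))))).
    { intro p; unfold tr; clear tr; destruct p; simpl.
      now rewrite eq_trans_sym_inv_r. }
    intros p q; rewrite (K p), (K q).
    assert (E : tr p = tr q).
    { unfold tr; f_equal; apply (cell2_is_set (bicat_laws B)). }
    now rewrite E.
  Qed.

  Lemma mnd_unit_law_iff (S T : Monad B) (f : cell1 S T)
    (n : mnd_endo S · f ==> f · mnd_endo T) :
    mnd_mor_unit_law n <->
    forall (c : B) (h : cell1 c S),
      (st_unit (mnd_unit S) h ▷ f) • st_sq n h = st_unit (mnd_unit T) (h · f).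
  Proof.
    unfold mnd_mor_unit_law, st_unit, st_sq.
    apply law_iff with
      (p := fun c h => lassociator h (id1 (mnd_ob S)) f • (runitor h ▷ f))
      (q := fun c h => rassociator h f (mnd_endo T)); intros.
    - exact (is_inv2_vcomp (is_inv2_lassociator _ _ _)
               (is_inv2_rwhisker f (is_inv2_runitor h))).
    - apply is_inv2_rassociator.
    - now strictify.
    - now strictify.
  Qed.

  Lemma mnd_mult_law_iff (S T : Monad B) (f : cell1 S T)
    (n : mnd_endo S · f ==> f · mnd_endo T) :
    mnd_mor_mult_law n <->
    forall (c : B) (h : cell1 c S),
      (st_mult (mnd_mult S) h ▷ f) • st_sq n h
      = st_sq n (h · mnd_endo S) • (st_sq n h ▷ mnd_endo T)
        • st_mult (mnd_mult T) (h · f).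
  Proof.
    unfold mnd_mor_mult_law, st_mult, st_sq.
    apply law_iff with
      (p := fun c h => lassociator h (mnd_endo S · mnd_endo S) f
                       • (lassociator h (mnd_endo S) (mnd_endo S) ▷ f))
      (q := fun c h => rassociator h f (mnd_endo T)); intros.
    - exact (is_inv2_vcomp (is_inv2_lassociator _ _ _)
               (is_inv2_rwhisker f (is_inv2_lassociator h _ _))).
    - apply is_inv2_rassociator.
    - now strictify.
    - now strictify.
  Qed.

  Lemma mnd_cell_law_iff (S T : Monad B) (f g : MonadMor S T)
    (x : cell2 (mnd_mor_cell1 f) (mnd_mor_cell1 g)) :
    mnd_mor_cell2 f • (x ▷ mnd_endo T) = (mnd_endo S ◁ x) • mnd_mor_cell2 g <->
    forall (c : B) (h : cell1 c S),
      st_sq (mnd_mor_cell2 f) h • ((h ◁ x) ▷ mnd_endo T)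
      = (h · mnd_endo S ◁ x) • st_sq (mnd_mor_cell2 g) h.
  Proof.
    unfold st_sq.
    apply law_iff with
      (p := fun c h => lassociator h (mnd_endo S) f)
      (q := fun c h => rassociator h g (mnd_endo T)); intros.
    - apply is_inv2_lassociator.
    - apply is_inv2_rassociator.
    - now strictify.
    - now strictify.
  Qed.

  Definition mnd_id1_cell2 (S : Monad B) :
    mnd_endo S · id1 (mnd_ob S) ==> id1 (mnd_ob S) · mnd_endo S :=
    runitor (mnd_endo S) • linvunitor (mnd_endo S).

  Lemma st_sq_mnd_id1 (S : Monad B) (c : B) (h : cell1 c S) :
    st_sq (mnd_id1_cell2 S) h
    = runitor (h · mnd_endo S) • (rinvunitor h ▷ mnd_endo S).
  Proof. unfold st_sq, mnd_id1_cell2; now strictify. Qed.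

  Definition mnd_comp1_cell2 (S T U : Monad B) (f : cell1 S T) (g : cell1 T U)
    (n : mnd_endo S · f ==> f · mnd_endo T) (k : mnd_endo T · g ==> g · mnd_endo U) :
    mnd_endo S · (f · g) ==> f · g · mnd_endo U :=
    lassociator (mnd_endo S) f g
    • (n ▷ g)
    • rassociator f (mnd_endo T) g
    • (f ◁ k)
    • lassociator f g (mnd_endo U).

  Lemma st_sq_mnd_comp1 (S T U : Monad B) (f : cell1 S T) (g : cell1 T U)
    (n : mnd_endo S · f ==> f · mnd_endo T) (k : mnd_endo T · g ==> g · mnd_endo U)
    (c : B) (h : cell1 c S) :
    st_sq (mnd_comp1_cell2 n k) h
    = lassociator (h · mnd_endo S) f g
      • (st_sq n h ▷ g)
      • st_sq k (h · f)
      • (rassociator h f g ▷ mnd_endo U).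
  Proof. unfold st_sq, mnd_comp1_cell2; now strictify. Qed.

  Definition mnd_id1 (S : Monad B) : MonadMor S S.
  Proof.
    refine {| mnd_mor_cell1 := id1 (mnd_ob S);
              mnd_mor_cell2 := mnd_id1_cell2 S |}.
    - exact (is_inv2_vcomp (is_inv2_runitor _) (is_inv2_linvunitor _)).
    - abstract (apply mnd_unit_law_iff; intros; rewrite st_sq_mnd_id1;
        rewrite (vcomp_pre (runitor_natural (bicat_laws B) (st_unit (mnd_unit S) h))), vass;
        rewrite <- st_unit_natural; now strictify).
    - abstract (apply mnd_mult_law_iff; intros; rewrite !st_sq_mnd_id1;
        rewrite (vcomp_pre (runitor_natural (bicat_laws B) (st_mult (mnd_mult S) h))), vass;
        rewrite <- st_mult_natural; now strictify).
  Defined.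

  Definition mnd_comp1 (S T U : Monad B) (f : MonadMor S T) (g : MonadMor T U) :
    MonadMor S U.
  Proof.
    refine {| mnd_mor_cell1 := mnd_mor_cell1 f · mnd_mor_cell1 g;
              mnd_mor_cell2 := mnd_comp1_cell2 (mnd_mor_cell2 f) (mnd_mor_cell2 g) |}.
    - exact (is_inv2_vcomp (is_inv2_lassociator _ _ _)
               (is_inv2_vcomp (is_inv2_rwhisker g (mnd_mor_is_inv2 f))
               (is_inv2_vcomp (is_inv2_rassociator _ _ _)
               (is_inv2_vcomp (is_inv2_lwhisker f (mnd_mor_is_inv2 g))
               (is_inv2_lassociator _ _ _))))).
    - abstract (
        pose proof (proj1 (mnd_unit_law_iff _) (mnd_mor_unit f)) as Ef;
        pose proof (proj1 (mnd_unit_law_iff _) (mnd_mor_unit g)) as Eg;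
        apply mnd_unit_law_iff; intros; rewrite st_sq_mnd_comp1; strictify;
        rewrite (vcomp_pre (x := st_unit (mnd_unit S) h ▷ f ▷ g) (eq_sym (rw_vcomp g _ _)));
        rewrite Ef, (vcomp_pre (Eg _ _)), (vcomp_pre (st_unit_natural _ _)), vass;
        now strictify).
    - abstract (
        pose proof (proj1 (mnd_mult_law_iff _) (mnd_mor_mult f)) as Ef;
        pose proof (proj1 (mnd_mult_law_iff _) (mnd_mor_mult g)) as Eg;
        apply mnd_mult_law_iff; intros; rewrite !st_sq_mnd_comp1; strictify;
        rewrite (vcomp_pre (x := st_mult (mnd_mult S) h ▷ f ▷ g) (eq_sym (rw_vcomp g _ _)));
        rewrite Ef, !rw_vcomp, !vass, (vcomp_pre (Eg _ _)), !vass;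
        rewrite st_mult_natural;
        now rewrite (vcomp_pre (st_sq_natural _ (st_sq (mnd_mor_cell2 f) h))), !vass).
  Defined.

  Definition mnd_id2 (S T : Monad B) (f : MonadMor S T) : MonadCell f f.
  Proof.
    refine {| mnd_cell := id2 (mnd_mor_cell1 f) |}.
    abstract (now strictify).
  Defined.

  Definition mnd_vcomp (S T : Monad B) (f g h : MonadMor S T)
    (x : MonadCell f g) (y : MonadCell g h) : MonadCell f h.
  Proof.
    refine {| mnd_cell := mnd_cell x • mnd_cell y |}.
    abstract (rewrite rw_vcomp, lw_vcomp, (vcomp_pre (mnd_cell_law x)), !vass;
              now rewrite mnd_cell_law).
  Defined.

  Definition mnd_lwhisker (S T U : Monad B) (f : MonadMor S T) (g h : MonadMor T U)
    (x : MonadCell g h) : MonadCell (mnd_comp1 f g) (mnd_comp1 f h).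
  Proof.
    refine {| mnd_cell := mnd_mor_cell1 f ◁ mnd_cell x :
                cell2 (mnd_mor_cell1 (mnd_comp1 f g)) (mnd_mor_cell1 (mnd_comp1 f h)) |}.
    abstract (
      pose proof (proj1 (mnd_cell_law_iff _) (mnd_cell_law x)) as E;
      apply mnd_cell_law_iff; intros c k; simpl; rewrite !st_sq_mnd_comp1; strictify;
      rewrite (vcomp_pre (E _ _)), !vass;
      now rewrite (vcomp_pre (vcomp_whisker (bicat_laws B)
                                (st_sq (mnd_mor_cell2 f) k) (mnd_cell x))), !vass).
  Defined.

  Definition mnd_rwhisker (S T U : Monad B) (f g : MonadMor S T) (h : MonadMor T U)
    (x : MonadCell f g) : MonadCell (mnd_comp1 f h) (mnd_comp1 g h).
  Proof.
    refine {| mnd_cell := mnd_cell x ▷ mnd_mor_cell1 h :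
                cell2 (mnd_mor_cell1 (mnd_comp1 f h)) (mnd_mor_cell1 (mnd_comp1 g h)) |}.
    abstract (
      pose proof (proj1 (mnd_cell_law_iff _) (mnd_cell_law x)) as E;
      apply mnd_cell_law_iff; intros c k; simpl; rewrite !st_sq_mnd_comp1; strictify;
      rewrite (vcomp_pre (eq_sym (st_sq_natural (mnd_mor_cell2 h) (k ◁ mnd_cell x)))), !vass;
      rewrite (vcomp_pre (x := st_sq (mnd_mor_cell2 f) k ▷ h) (eq_sym (rw_vcomp h _ _)));
      now rewrite E, rw_vcomp, !vass).
  Defined.

  Definition mnd_lunitor (S T : Monad B) (f : MonadMor S T) :
    MonadCell (mnd_comp1 (mnd_id1 S) f) f.
  Proof.
    refine {| mnd_cell := lunitor (mnd_mor_cell1 f) :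
                cell2 (mnd_mor_cell1 (mnd_comp1 (mnd_id1 S) f)) (mnd_mor_cell1 f) |}.
    abstract (apply mnd_cell_law_iff; intros c k; simpl; rewrite !st_sq_mnd_comp1; strictify;
      rewrite st_sq_mnd_id1; strictify;
      rewrite <- st_sq_natural; rewrite (vcomp_pre (rw_cancel f (rw_cancel _ (riu_ru k))));
      now rewrite id2l).
  Defined.

  Definition mnd_runitor (S T : Monad B) (f : MonadMor S T) :
    MonadCell (mnd_comp1 f (mnd_id1 T)) f.
  Proof.
    refine {| mnd_cell := runitor (mnd_mor_cell1 f) :
                cell2 (mnd_mor_cell1 (mnd_comp1 f (mnd_id1 T))) (mnd_mor_cell1 f) |}.
    abstract (apply mnd_cell_law_iff; intros c k; simpl; rewrite !st_sq_mnd_comp1; strictify;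
      rewrite st_sq_mnd_id1; strictify;
      now rewrite (runitor_natural (bicat_laws B))).
  Defined.

  Definition mnd_lassociator (S1 S2 S3 S4 : Monad B)
    (f : MonadMor S1 S2) (g : MonadMor S2 S3) (h : MonadMor S3 S4) :
    MonadCell (mnd_comp1 f (mnd_comp1 g h)) (mnd_comp1 (mnd_comp1 f g) h).
  Proof.
    refine {| mnd_cell := lassociator (mnd_mor_cell1 f) (mnd_mor_cell1 g) (mnd_mor_cell1 h) :
                cell2 (mnd_mor_cell1 (mnd_comp1 f (mnd_comp1 g h)))
                      (mnd_mor_cell1 (mnd_comp1 (mnd_comp1 f g) h)) |}.
    abstract (apply mnd_cell_law_iff; intros c k; simpl; rewrite !st_sq_mnd_comp1; strictify;
      now rewrite (vcomp_pre (st_sq_natural (mnd_mor_cell2 h) (rassociator k f g))), !vass).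
  Defined.

  Definition mnd_inv2 (S T : Monad B) (f g : MonadMor S T) (x : MonadCell f g)
    (Hx : is_inv2 (mnd_cell x)) : MonadCell g f.
  Proof.
    refine {| mnd_cell := inv2 Hx |}.
    abstract (
      apply (cancel_l (is_inv2_lwhisker (mnd_endo S) Hx));
      apply (cancel_r (is_inv2_rwhisker (mnd_endo T) Hx));
      rewrite !vass, (vcomp_pre (eq_sym (mnd_cell_law x))), !vass;
      rewrite (vcomp_pre (lw_cancel (mnd_endo S) (vcomp_inv2 Hx))), id2l;
      rewrite (rw_cancel (mnd_endo T) (inv2_vcomp Hx)), id2r;
      reflexivity).
  Defined.

  Definition mnd_bicat_data : BicatData := {|
    bob := Monad B;
    cell1 := fun S T => MonadMor S T;
    cell2 := fun S T f g => MonadCell f g;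
    id1 := fun S => mnd_id1 S;
    comp1 := fun S T U f g => mnd_comp1 f g;
    id2 := fun S T f => mnd_id2 f;
    vcomp := fun S T f g h x y => mnd_vcomp x y;
    lwhisker := fun S T U f g h x => mnd_lwhisker f x;
    rwhisker := fun S T U f g h x => mnd_rwhisker h x;
    lunitor := fun S T f => mnd_lunitor f;
    linvunitor := fun S T f =>
      mnd_inv2 (x := mnd_lunitor f) (is_inv2_lunitor (mnd_mor_cell1 f));
    runitor := fun S T f => mnd_runitor f;
    rinvunitor := fun S T f =>
      mnd_inv2 (x := mnd_runitor f) (is_inv2_runitor (mnd_mor_cell1 f));
    lassociator := fun S1 S2 S3 S4 f g h => mnd_lassociator f g h;
    rassociator := fun S1 S2 S3 S4 f g h =>
      mnd_inv2 (x := mnd_lassociator f g h)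
        (is_inv2_lassociator (mnd_mor_cell1 f) (mnd_mor_cell1 g) (mnd_mor_cell1 h))
  |}.

  Lemma mnd_bicat_laws : BicatLaws mnd_bicat_data.
  Proof.
    destruct (bicat_laws B).
    split; try (intros; apply mnd_cell_is_set);
      simpl; intros; apply mnd_cell_eq; simpl; auto.
  Qed.
End MonadBicat.

Definition MonadBicat (B : Bicat) : Bicat :=
  {| bicat_data := mnd_bicat_data B; bicat_laws := mnd_bicat_laws B |}.

Close Scope bicat_scope.
Open Scope hom_scope.

Record KleisliTriple : Type := {
  kt_cat :> UnivCat;
  kt_ob : kt_cat -> kt_cat;
  kt_unit : forall a : kt_cat, hom a (kt_ob a);
  kt_bind : forall a b : kt_cat, hom a (kt_ob b) -> hom (kt_ob a) (kt_ob b);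
  kt_bind_unit : forall a : kt_cat, kt_bind (kt_unit a) = idm (kt_ob a);
  kt_unit_bind : forall (a b : kt_cat) (f : hom a (kt_ob b)),
    kt_unit a · kt_bind f = f;
  kt_bind_bind : forall (a b c : kt_cat) (f : hom a (kt_ob b)) (g : hom b (kt_ob c)),
    kt_bind f · kt_bind g = kt_bind (f · kt_bind g)
}.

Arguments kt_ob {_} _.
Arguments kt_unit {_} _.
Arguments kt_bind {_ _ _} _.

Definition kt_map (C : KleisliTriple) (x y : C) (h : hom x y) :
  hom (kt_ob x) (kt_ob y) := kt_bind (h · kt_unit y).

Record KleisliMor (C D : KleisliTriple) : Type := {
  km_functor :> Functor C D;
  km_iso : forall a : C, iso (kt_ob (km_functor a)) (km_functor (kt_ob a));
  km_unit : forall a : C, kt_unit (km_functor a) · km_iso a = fmap km_functor (kt_unit a);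
  km_bind : forall (a b : C) (f : hom a (kt_ob b)),
    km_iso a · fmap km_functor (kt_bind f)
    = kt_bind (fmap km_functor f · iso_inv (km_iso b)) · km_iso b
}.

Arguments km_iso {_ _} _ _.

Record KleisliCell (C D : KleisliTriple) (F G : KleisliMor C D) : Type := {
  kc_nat :> NatTrans F G;
  kc_law : forall a : C,
    km_iso F a · kc_nat (kt_ob a) = kt_map (kc_nat a) · km_iso G a
}.

Lemma kleisli_cell_eq (C D : KleisliTriple) (F G : KleisliMor C D)
  (x y : KleisliCell F G) : (forall a, x a = y a) -> x = y.
Proof.
  intros E; apply nat_trans_eq in E.
  destruct x as [x Hx], y as [y Hy]; simpl in E; subst y; f_equal.
  apply functional_extensionality_dep; intro; apply hom_is_set.
Qed.

Lemma kleisli_cell_is_set (C D : KleisliTriple) (F G : KleisliMor C D) :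
  is_set (KleisliCell F G).
Proof.
  intros x y.
  set (tr := fun p : x = y =>
    kleisli_cell_eq (fun a => f_equal (fun u : KleisliCell F G => u a) p)).
  assert (K : forall p : x = y,
             p = eq_trans (tr p)
                   (eq_sym (kleisli_cell_eq (fun a : C => eq_refl (y a))))).
  { intro p; unfold tr; clear tr; destruct p; simpl.
    now rewrite eq_trans_sym_inv_r. }
  intros p q; rewrite (K p), (K q).
  assert (E : tr p = tr q).
  { unfold tr; f_equal.
    apply functional_extensionality_dep; intro; apply hom_is_set. }
  now rewrite E.
Qed.

Section KleisliMap.
  Context (C : KleisliTriple).

  Lemma kt_unit_map (x y : C) (h : hom x y) :
    kt_unit x · kt_map h = h · kt_unit y.
  Proof. apply kt_unit_bind. Qed.

  Lemma kt_map_id (x : C) : kt_map (idm x) = idm (kt_ob x).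
  Proof. unfold kt_map; rewrite comp_id_l; apply kt_bind_unit. Qed.

  Lemma kt_map_comp (x y z : C) (f : hom x y) (g : hom y z) :
    kt_map (f · g) = kt_map f · kt_map g.
  Proof.
    unfold kt_map; rewrite kt_bind_bind, <- !comp_assoc, kt_unit_bind; reflexivity.
  Qed.
End KleisliMap.

Lemma km_map (C D : KleisliTriple) (F : KleisliMor C D) (x y : C) (h : hom x y) :
  km_iso F x · fmap F (kt_map h) = kt_map (fmap F h) · km_iso F y.
Proof.
  unfold kt_map; rewrite km_bind, fmap_comp, <- (km_unit F y).
  now rewrite <- !comp_assoc, iso_mor_inv, comp_id_r.
Qed.

Definition comp_iso (C : Category) (x y z : C) (f : iso x y) (g : iso y z) : iso x z.
Proof.
  refine {| iso_mor := f · g; iso_inv := iso_inv g · iso_inv f |}.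
  - abstract (rewrite <- comp_assoc, (comp_assoc g), iso_mor_inv, comp_id_l;
              apply iso_mor_inv).
  - abstract (rewrite <- comp_assoc, (comp_assoc (iso_inv f)), iso_inv_mor, comp_id_l;
              apply iso_inv_mor).
Defined.

Definition fmap_iso (C D : Category) (F : Functor C D) (x y : C) (f : iso x y) :
  iso (F x) (F y).
Proof.
  refine {| iso_mor := fmap F f; iso_inv := fmap F (iso_inv f) |}.
  - abstract (now rewrite <- fmap_comp, iso_mor_inv, fmap_id).
  - abstract (now rewrite <- fmap_comp, iso_inv_mor, fmap_id).
Defined.

Definition kleisli_id1 (C : KleisliTriple) : KleisliMor C C.
Proof.
  refine {| km_functor := id_functor C;
            km_iso := fun a => id_iso (kt_ob a) :
              iso (kt_ob (id_functor C a)) (id_functor C (kt_ob a)) |}.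
  - abstract (intros; apply comp_id_r).
  - abstract (intros; simpl; now rewrite comp_id_l, !comp_id_r).
Defined.

Definition kleisli_comp1 (C D E : KleisliTriple)
  (F : KleisliMor C D) (G : KleisliMor D E) : KleisliMor C E.
Proof.
  refine {| km_functor := comp_functor F G;
            km_iso := fun a => comp_iso (km_iso G (F a)) (fmap_iso G (km_iso F a)) :
              iso (kt_ob (comp_functor F G a)) (comp_functor F G (kt_ob a)) |}.
  - abstract (intros; simpl; now rewrite comp_assoc, km_unit, <- fmap_comp, km_unit).
  - abstract (intros; simpl;
      now rewrite <- comp_assoc, <- fmap_comp, km_bind, fmap_comp, comp_assoc,
        km_bind, fmap_comp, !comp_assoc).
Defined.

Definition kleisli_id2 (C D : KleisliTriple) (F : KleisliMor C D) : KleisliCell F F.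
Proof.
  refine {| kc_nat := id_nat F |}.
  abstract (intros; simpl; now rewrite kt_map_id, comp_id_l, comp_id_r).
Defined.

Definition kleisli_vcomp (C D : KleisliTriple) (F G H : KleisliMor C D)
  (s : KleisliCell F G) (t : KleisliCell G H) : KleisliCell F H.
Proof.
  refine {| kc_nat := comp_nat s t |}.
  abstract (intros; simpl;
    now rewrite comp_assoc, kc_law, <- comp_assoc, kc_law, comp_assoc, kt_map_comp).
Defined.

Definition kleisli_lwhisker (C D E : KleisliTriple) (F : KleisliMor C D)
  (G H : KleisliMor D E) (s : KleisliCell G H) :
  KleisliCell (kleisli_comp1 F G) (kleisli_comp1 F H).
Proof.
  refine {| kc_nat := whisker_l F s :
    NatTrans (kleisli_comp1 F G) (kleisli_comp1 F H) |}.
  abstract (intros; simpl;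
    now rewrite <- comp_assoc, nt_natural, comp_assoc, kc_law, comp_assoc).
Defined.

Definition kleisli_rwhisker (C D E : KleisliTriple) (F G : KleisliMor C D)
  (H : KleisliMor D E) (s : KleisliCell F G) :
  KleisliCell (kleisli_comp1 F H) (kleisli_comp1 G H).
Proof.
  refine {| kc_nat := whisker_r H s :
    NatTrans (kleisli_comp1 F H) (kleisli_comp1 G H) |}.
  abstract (intros; simpl;
    now rewrite <- comp_assoc, <- fmap_comp, kc_law, fmap_comp, comp_assoc,
      km_map, comp_assoc).
Defined.

Section KleisliStructural.
  Local Ltac ids :=
    abstract (intros; simpl; rewrite kt_map_id, comp_id_l, ?comp_id_r;
              rewrite ?fmap_id, ?fmap_comp, ?comp_assoc, ?comp_id_l, ?comp_id_r;
              reflexivity).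

  Context (C D : KleisliTriple) (F : KleisliMor C D).

  Definition kleisli_lunitor : KleisliCell (kleisli_comp1 (kleisli_id1 C) F) F.
  Proof.
    refine {| kc_nat := lunitor_nat F :
      NatTrans (kleisli_comp1 (kleisli_id1 C) F) F |}; ids.
  Defined.

  Definition kleisli_linvunitor : KleisliCell F (kleisli_comp1 (kleisli_id1 C) F).
  Proof.
    refine {| kc_nat := linvunitor_nat F :
      NatTrans F (kleisli_comp1 (kleisli_id1 C) F) |}; ids.
  Defined.

  Definition kleisli_runitor : KleisliCell (kleisli_comp1 F (kleisli_id1 D)) F.
  Proof.
    refine {| kc_nat := runitor_nat F :
      NatTrans (kleisli_comp1 F (kleisli_id1 D)) F |}; ids.
  Defined.

  Definition kleisli_rinvunitor : KleisliCell F (kleisli_comp1 F (kleisli_id1 D)).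
  Proof.
    refine {| kc_nat := rinvunitor_nat F :
      NatTrans F (kleisli_comp1 F (kleisli_id1 D)) |}; ids.
  Defined.

  Context (D' D'' : KleisliTriple) (G : KleisliMor D D') (H : KleisliMor D' D'').

  Definition kleisli_lassociator :
    KleisliCell (kleisli_comp1 F (kleisli_comp1 G H)) (kleisli_comp1 (kleisli_comp1 F G) H).
  Proof.
    refine {| kc_nat := lassociator_nat F G H :
      NatTrans (kleisli_comp1 F (kleisli_comp1 G H))
               (kleisli_comp1 (kleisli_comp1 F G) H) |}; ids.
  Defined.

  Definition kleisli_rassociator :
    KleisliCell (kleisli_comp1 (kleisli_comp1 F G) H) (kleisli_comp1 F (kleisli_comp1 G H)).
  Proof.
    refine {| kc_nat := rassociator_nat F G H :
      NatTrans (kleisli_comp1 (kleisli_comp1 F G) H)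
               (kleisli_comp1 F (kleisli_comp1 G H)) |}; ids.
  Defined.
End KleisliStructural.

Definition kleisli_bicat_data : BicatData := {|
  bob := KleisliTriple;
  cell1 := fun C D => KleisliMor C D;
  cell2 := fun C D F G => KleisliCell F G;
  id1 := fun C => kleisli_id1 C;
  comp1 := fun C D E F G => kleisli_comp1 F G;
  id2 := fun C D F => kleisli_id2 F;
  vcomp := fun C D F G H s t => kleisli_vcomp s t;
  lwhisker := fun C D E F G H s => kleisli_lwhisker F s;
  rwhisker := fun C D E F G H s => kleisli_rwhisker H s;
  lunitor := fun C D F => kleisli_lunitor F;
  linvunitor := fun C D F => kleisli_linvunitor F;
  runitor := fun C D F => kleisli_runitor F;
  rinvunitor := fun C D F => kleisli_rinvunitor F;
  lassociator := fun C1 C2 C3 C4 F G H => kleisli_lassociator F G H;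
  rassociator := fun C1 C2 C3 C4 F G H => kleisli_rassociator F G H
|}.

Lemma kleisli_bicat_laws : BicatLaws kleisli_bicat_data.
Proof.
  split; try (intros; apply kleisli_cell_is_set);
    simpl; intros; apply kleisli_cell_eq; intro; simpl;
    rewrite ?fmap_id, ?fmap_comp, ?comp_id_l, ?comp_id_r;
    rewrite ?comp_assoc, ?comp_id_l, ?comp_id_r; try reflexivity.
  all: first [ apply nt_natural | symmetry; apply nt_natural ].
Qed.

Definition KleisliBicat : Bicat :=
  {| bicat_data := kleisli_bicat_data; bicat_laws := kleisli_bicat_laws |}.

Close Scope hom_scope.
Open Scope bicat_scope.

Record PseudoFunctor (B C : BicatData) : Type := {
  psf_ob :> B -> C;
  psf1 : forall a b : B, cell1 a b -> cell1 (psf_ob a) (psf_ob b);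
  psf2 : forall (a b : B) (f g : cell1 a b), f ==> g -> psf1 f ==> psf1 g;
  psf_id : forall a : B, id1 (psf_ob a) ==> psf1 (id1 a);
  psf_comp : forall (a b c : B) (f : cell1 a b) (g : cell1 b c),
    psf1 f · psf1 g ==> psf1 (f · g);
  psf_id_is_inv2 : forall a : B, is_inv2 (psf_id a);
  psf_comp_is_inv2 : forall (a b c : B) (f : cell1 a b) (g : cell1 b c),
    is_inv2 (psf_comp f g);
  psf2_id2 : forall (a b : B) (f : cell1 a b), psf2 (id2 f) = id2 (psf1 f);
  psf2_vcomp : forall (a b : B) (f g h : cell1 a b) (x : f ==> g) (y : g ==> h),
    psf2 (x • y) = psf2 x • psf2 y;
  psf_lunitor : forall (a b : B) (f : cell1 a b),
    lunitor (psf1 f)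
    = (psf_id a ▷ psf1 f) • psf_comp (id1 a) f • psf2 (lunitor f);
  psf_runitor : forall (a b : B) (f : cell1 a b),
    runitor (psf1 f)
    = (psf1 f ◁ psf_id b) • psf_comp f (id1 b) • psf2 (runitor f);
  psf_lassociator : forall (a b c d : B)
    (f : cell1 a b) (g : cell1 b c) (h : cell1 c d),
    (psf1 f ◁ psf_comp g h) • psf_comp f (g · h) • psf2 (lassociator f g h)
    = lassociator (psf1 f) (psf1 g) (psf1 h)
      • (psf_comp f g ▷ psf1 h) • psf_comp (f · g) h;
  psf_lwhisker : forall (a b c : B) (f : cell1 a b) (g h : cell1 b c) (x : g ==> h),
    psf_comp f g • psf2 (f ◁ x) = (psf1 f ◁ psf2 x) • psf_comp f h;
  psf_rwhisker : forall (a b c : B) (f g : cell1 a b) (h : cell1 b c) (x : f ==> g),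
    psf_comp f h • psf2 (x ▷ h) = (psf2 x ▷ psf1 h) • psf_comp g h
}.

Arguments psf1 {_ _} _ {_ _} _.
Arguments psf2 {_ _} _ {_ _ _ _} _.
Arguments psf_id {_ _} _ _.
Arguments psf_comp {_ _} _ {_ _ _} _ _.

Definition id_psf (B : Bicat) : PseudoFunctor B B.
Proof.
  refine {| psf_ob := fun a => a;
            psf1 := fun a b f => f;
            psf2 := fun a b f g x => x;
            psf_id := fun a => id2 (id1 a);
            psf_comp := fun a b c f g => id2 (f · g);
            psf_id_is_inv2 := fun a => is_inv2_id2 (id1 a);
            psf_comp_is_inv2 := fun a b c f g => is_inv2_id2 (f · g) |};
    abstract (intros; rewrite ?lw_id2, ?rw_id2, ?id2l, ?id2r; reflexivity).
Defined.

Definition psf2_is_inv2 (B C : Bicat) (F : PseudoFunctor B C) (a b : B)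
  (f g : cell1 a b) (x : f ==> g) (Hx : is_inv2 x) : is_inv2 (psf2 F x).
Proof.
  exists (psf2 F (inv2 Hx)).
  - abstract (now rewrite <- psf2_vcomp, vcomp_inv2, psf2_id2).
  - abstract (now rewrite <- psf2_vcomp, inv2_vcomp, psf2_id2).
Defined.

Definition comp_psf (B C D : Bicat) (F : PseudoFunctor B C) (G : PseudoFunctor C D) :
  PseudoFunctor B D.
Proof.
  refine {| psf_ob := fun a => G (F a);
            psf1 := fun a b f => psf1 G (psf1 F f);
            psf2 := fun a b f g x => psf2 G (psf2 F x);
            psf_id := fun a => psf_id G (F a) • psf2 G (psf_id F a);
            psf_comp := fun a b c f g =>
              psf_comp G (psf1 F f) (psf1 F g) • psf2 G (psf_comp F f g);
            psf_id_is_inv2 := fun a =>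
              is_inv2_vcomp (psf_id_is_inv2 G (F a))
                (psf2_is_inv2 G (psf_id_is_inv2 F a));
            psf_comp_is_inv2 := fun a b c f g =>
              is_inv2_vcomp (psf_comp_is_inv2 G (psf1 F f) (psf1 F g))
                (psf2_is_inv2 G (psf_comp_is_inv2 F f g)) |}.
  - abstract (intros; now rewrite !psf2_id2).
  - abstract (intros; now rewrite !psf2_vcomp).
  - abstract (intros; rewrite rw_vcomp, !vass;
      rewrite (vcomp_pre (eq_sym (psf_rwhisker G (psf1 F f) (psf_id F a)))), vass;
      now rewrite <- !psf2_vcomp, <- psf_lunitor, psf_lunitor).
  - abstract (intros; rewrite lw_vcomp, !vass;
      rewrite (vcomp_pre (eq_sym (psf_lwhisker G (psf1 F f) (psf_id F b)))), vass;
      now rewrite <- !psf2_vcomp, <- psf_runitor, psf_runitor).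
  - abstract (intros; rewrite lw_vcomp, rw_vcomp, !vass;
      rewrite (vcomp_pre (eq_sym (psf_lwhisker G (psf1 F f) (psf_comp F g h)))), vass;
      rewrite (vcomp_pre (eq_sym (psf_rwhisker G (psf1 F h) (psf_comp F f g)))), vass;
      rewrite <- !psf2_vcomp, psf_lassociator, !psf2_vcomp, <- !vass;
      pose proof (psf_lassociator G (psf1 F f) (psf1 F g) (psf1 F h)) as E;
      rewrite <- !vass in E; now rewrite E).
  - abstract (intros; rewrite !vass, <- psf2_vcomp, psf_lwhisker, psf2_vcomp;
      now rewrite (vcomp_pre (psf_lwhisker G (psf1 F f) (psf2 F x))), vass).
  - abstract (intros; rewrite !vass, <- psf2_vcomp, psf_rwhisker, psf2_vcomp;
      now rewrite (vcomp_pre (psf_rwhisker G (psf1 F h) (psf2 F x))), vass).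
Defined.

Definition ptrans_natural_law (B C : BicatData) (F G : PseudoFunctor B C)
  (s : forall a : B, cell1 (F a) (G a))
  (n : forall (a b : B) (f : cell1 a b), s a · psf1 G f ==> psf1 F f · s b) : Prop :=
  forall (a b : B) (f g : cell1 a b) (x : f ==> g),
    (s a ◁ psf2 G x) • n a b g = n a b f • (psf2 F x ▷ s b).

Definition ptrans_id_law (B C : BicatData) (F G : PseudoFunctor B C)
  (s : forall a : B, cell1 (F a) (G a))
  (n : forall (a b : B) (f : cell1 a b), s a · psf1 G f ==> psf1 F f · s b) : Prop :=
  forall a : B,
    (s a ◁ psf_id G a) • n a a (id1 a)
    = runitor (s a) • linvunitor (s a) • (psf_id F a ▷ s a).

Definition ptrans_comp_law (B C : BicatData) (F G : PseudoFunctor B C)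
  (s : forall a : B, cell1 (F a) (G a))
  (n : forall (a b : B) (f : cell1 a b), s a · psf1 G f ==> psf1 F f · s b) : Prop :=
  forall (a b c : B) (f : cell1 a b) (g : cell1 b c),
    (s a ◁ psf_comp G f g) • n a c (f · g)
    = lassociator (s a) (psf1 G f) (psf1 G g)
      • (n a b f ▷ psf1 G g)
      • rassociator (psf1 F f) (s b) (psf1 G g)
      • (psf1 F f ◁ n b c g)
      • lassociator (psf1 F f) (psf1 F g) (s c)
      • (psf_comp F f g ▷ s c).

(** The naturality cells are oriented as [s a · G f ==> F f · s b]. *)

Record PseudoTrans (B C : BicatData) (F G : PseudoFunctor B C) : Type := {
  pt_cell1 :> forall a : B, cell1 (F a) (G a);
  pt_cell2 : forall (a b : B) (f : cell1 a b),
    pt_cell1 a · psf1 G f ==> psf1 F f · pt_cell1 b;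
  pt_is_inv2 : forall (a b : B) (f : cell1 a b), is_inv2 (pt_cell2 f);
  pt_natural : ptrans_natural_law pt_cell2;
  pt_id : ptrans_id_law pt_cell2;
  pt_comp : ptrans_comp_law pt_cell2
}.

Arguments pt_cell2 {_ _ _ _} _ {_ _} _.

Section PseudoTransOps.
  Context (B C : Bicat).

  Section Laws.
    Context (F G : PseudoFunctor B C) (s : forall a : B, cell1 (F a) (G a)).
    Context (n : forall (a b : B) (f : cell1 a b), s a · psf1 G f ==> psf1 F f · s b).

    Lemma ptrans_natural_law_iff :
      ptrans_natural_law n <->
      forall (a b : B) (f g : cell1 a b) (x : f ==> g) (c : C) (h : cell1 c (F a)),
        (h · s a ◁ psf2 G x) • st_sq (n g) h
        = st_sq (n f) h • ((h ◁ psf2 F x) ▷ s b).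
    Proof.
      assert (K : forall (a b : B) (f g : cell1 a b) (x : f ==> g),
        (s a ◁ psf2 G x) • n g = n f • (psf2 F x ▷ s b) <->
        forall (c : C) (h : cell1 c (F a)),
        (h · s a ◁ psf2 G x) • st_sq (n g) h
        = st_sq (n f) h • ((h ◁ psf2 F x) ▷ s b)).
      { intros a b f g x; unfold st_sq.
        apply law_iff with
          (p := fun c h => lassociator h (s a) (psf1 G f))
          (q := fun c h => rassociator h (psf1 F g) (s b)); intros.
        - apply is_inv2_lassociator.
        - apply is_inv2_rassociator.
        - now strictify.
        - now strictify. }
      split; intros E a b f g x; apply K, E.
    Qed.

    Lemma ptrans_id_law_iff :
      ptrans_id_law n <->
      forall (a : B) (c : C) (h : cell1 c (F a)),
        st_unit (psf_id G a) (h · s a) • st_sq (n (id1 a)) h = st_unit (psf_id F a) h ▷ s a.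
    Proof.
      assert (K : forall a : B,
        (s a ◁ psf_id G a) • n (id1 a)
        = runitor (s a) • linvunitor (s a) • (psf_id F a ▷ s a) <->
        forall (c : C) (h : cell1 c (F a)),
        st_unit (psf_id G a) (h · s a) • st_sq (n (id1 a)) h = st_unit (psf_id F a) h ▷ s a).
      { intros a; unfold st_sq, st_unit.
        apply law_iff with
          (p := fun c h => lassociator h (s a) (id1 (G a)) • runitor (h · s a))
          (q := fun c h => rassociator h (psf1 F (id1 a)) (s a)); intros.
        - exact (is_inv2_vcomp (is_inv2_lassociator _ _ _) (is_inv2_runitor _)).
        - apply is_inv2_rassociator.
        - now strictify.
        - now strictify. }
      split; intros E a; apply K, E.
    Qed.

    Lemma ptrans_comp_law_iff :
      ptrans_comp_law n <->
      forall (a1 a2 a3 : B) (f : cell1 a1 a2) (g : cell1 a2 a3)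
        (c : C) (h : cell1 c (F a1)),
        st_mult (psf_comp G f g) (h · s a1) • st_sq (n (f · g)) h
        = (st_sq (n f) h ▷ psf1 G g)
          • st_sq (n g) (h · psf1 F f)
          • (st_mult (psf_comp F f g) h ▷ s a3).
    Proof.
      assert (K : forall (a1 a2 a3 : B) (f : cell1 a1 a2) (g : cell1 a2 a3),
        (s a1 ◁ psf_comp G f g) • n (f · g)
        = lassociator (s a1) (psf1 G f) (psf1 G g)
          • (n f ▷ psf1 G g)
          • rassociator (psf1 F f) (s a2) (psf1 G g)
          • (psf1 F f ◁ n g)
          • lassociator (psf1 F f) (psf1 F g) (s a3)
          • (psf_comp F f g ▷ s a3) <->
        forall (c : C) (h : cell1 c (F a1)),
        st_mult (psf_comp G f g) (h · s a1) • st_sq (n (f · g)) h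
        = (st_sq (n f) h ▷ psf1 G g)
          • st_sq (n g) (h · psf1 F f)
          • (st_mult (psf_comp F f g) h ▷ s a3)).
      { intros a1 a2 a3 f g; unfold st_sq, st_mult.
        apply law_iff with
          (p := fun c h => lassociator h (s a1) (psf1 G f · psf1 G g)
                           • lassociator (h · s a1) (psf1 G f) (psf1 G g))
          (q := fun c h => rassociator h (psf1 F (f · g)) (s a3)); intros.
        - exact (is_inv2_vcomp (is_inv2_lassociator _ _ _) (is_inv2_lassociator _ _ _)).
        - apply is_inv2_rassociator.
        - now strictify.
        - now strictify. }
      split; intros E a1 a2 a3 f g; apply K, E.
    Qed.
  End Laws.

  Definition pt_id_cell2 (F : PseudoFunctor B C) (a b : B) (f : cell1 a b) :
    id1 (F a) · psf1 F f ==> psf1 F f · id1 (F b) :=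
    lunitor (psf1 F f) • rinvunitor (psf1 F f).

  Lemma st_sq_id (F : PseudoFunctor B C) (a b : B) (f : cell1 a b)
    (c : C) (h : cell1 c (F a)) :
    st_sq (pt_id_cell2 F f) h = (runitor h ▷ psf1 F f) • rinvunitor (h · psf1 F f).
  Proof. unfold st_sq, pt_id_cell2; now strictify. Qed.

  Definition id_ptrans (F : PseudoFunctor B C) : PseudoTrans F F.
  Proof.
    refine {| pt_cell1 := fun a => id1 (F a);
              pt_cell2 := fun a b f => pt_id_cell2 F f;
              pt_is_inv2 := fun a b f =>
                is_inv2_vcomp (is_inv2_lunitor (psf1 F f)) (is_inv2_rinvunitor (psf1 F f)) |}.
    - abstract (apply ptrans_natural_law_iff; intros; rewrite !st_sq_id, !vass;
        rewrite rinvunitor_natural;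
        now rewrite (vcomp_pre (eq_sym (vcomp_whisker (bicat_laws C) (runitor h) (psf2 F x)))), vass).
    - abstract (apply ptrans_id_law_iff; intros; rewrite !st_sq_id;
        rewrite (vcomp_pre (eq_sym (st_unit_natural _ _))), vass;
        rewrite <- rinvunitor_natural, (vcomp_pre (ru_riu h)); apply id2l).
    - abstract (apply ptrans_comp_law_iff; intros; rewrite !st_sq_id; strictify;
        rewrite (vcomp_pre (eq_sym (st_mult_natural _ _))), vass;
        now rewrite <- rinvunitor_natural).
  Defined.

  Definition pt_comp_cell2 (F G H : PseudoFunctor B C)
    (s : PseudoTrans F G) (t : PseudoTrans G H) (a b : B) (f : cell1 a b) :
    s a · t a · psf1 H f ==> psf1 F f · (s b · t b) :=
    rassociator (s a) (t a) (psf1 H f)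
    • (s a ◁ pt_cell2 t f)
    • lassociator (s a) (psf1 G f) (t b)
    • (pt_cell2 s f ▷ t b)
    • rassociator (psf1 F f) (s b) (t b).

  Lemma st_sq_comp (F G H : PseudoFunctor B C)
    (s : PseudoTrans F G) (t : PseudoTrans G H) (a b : B) (f : cell1 a b)
    (c : C) (h : cell1 c (F a)) :
    st_sq (pt_comp_cell2 s t f) h
    = (lassociator h (s a) (t a) ▷ psf1 H f)
      • st_sq (pt_cell2 t f) (h · s a)
      • (st_sq (pt_cell2 s f) h ▷ t b)
      • rassociator (h · psf1 F f) (s b) (t b).
  Proof. unfold st_sq, pt_comp_cell2; now strictify. Qed.

  Definition comp_ptrans (F G H : PseudoFunctor B C)
    (s : PseudoTrans F G) (t : PseudoTrans G H) : PseudoTrans F H.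
  Proof.
    refine {| pt_cell1 := fun a => s a · t a;
              pt_cell2 := fun a b f => pt_comp_cell2 s t f;
              pt_is_inv2 := fun a b f =>
                is_inv2_vcomp (is_inv2_rassociator _ _ _)
                (is_inv2_vcomp (is_inv2_lwhisker (s a) (pt_is_inv2 t f))
                (is_inv2_vcomp (is_inv2_lassociator _ _ _)
                (is_inv2_vcomp (is_inv2_rwhisker (t b) (pt_is_inv2 s f))
                (is_inv2_rassociator _ _ _)))) |}.
    - abstract (
      pose proof (proj1 (ptrans_natural_law_iff _) (pt_natural s)) as Es;
      pose proof (proj1 (ptrans_natural_law_iff _) (pt_natural t)) as Et;
      apply ptrans_natural_law_iff; intros; rewrite !st_sq_comp; strictify;
        rewrite (vcomp_pre (eq_sym (vcomp_whisker (bicat_laws C) (lassociator h (s a) (t a)) (psf2 H x)))), vass;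
        rewrite (vcomp_pre (Et _ _ _ _ _ _ _)), vass;
        rewrite (vcomp_pre (x := (h · s a ◁ psf2 G x) ▷ t b) (eq_sym (rw_vcomp (t b) _ _)));
        now rewrite Es, rw_vcomp, vass).
    - abstract (
      pose proof (proj1 (ptrans_id_law_iff _) (pt_id s)) as Es;
      pose proof (proj1 (ptrans_id_law_iff _) (pt_id t)) as Et;
      apply ptrans_id_law_iff; intros; rewrite !st_sq_comp; strictify;
        rewrite (vcomp_pre (eq_sym (st_unit_natural _ _))), vass;
        rewrite (vcomp_pre (Et _ _ _));
        rewrite (vcomp_pre (x := st_unit _ _ ▷ t a) (eq_sym (rw_vcomp (t a) _ _)));
        now rewrite Es).
    - abstract (
      pose proof (proj1 (ptrans_comp_law_iff _) (pt_comp s)) as Es;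
      pose proof (proj1 (ptrans_comp_law_iff _) (pt_comp t)) as Et;
      apply ptrans_comp_law_iff; intros; rewrite !st_sq_comp; strictify;
        rewrite (vcomp_pre (eq_sym (st_mult_natural _ _))), vass;
        rewrite (vcomp_pre (Et _ _ _ _ _ _ _)), !vass;
        rewrite (vcomp_pre (x := st_mult _ _ ▷ t a3) (eq_sym (rw_vcomp (t a3) _ _)));
        rewrite Es, !rw_vcomp, !vass;
        now rewrite (vcomp_pre (st_sq_natural _ (st_sq (pt_cell2 s f) h))), !vass).
  Defined.
End PseudoTransOps.

Record Modification (B C : BicatData) (F G : PseudoFunctor B C)
  (s t : PseudoTrans F G) : Type := {
  mod_cell :> forall a : B, s a ==> t a;
  mod_law : forall (a b : B) (f : cell1 a b),
    pt_cell2 s f • (psf1 F f ◁ mod_cell b) = (mod_cell a ▷ psf1 G f) • pt_cell2 t f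
}.

(** A modification is invertible if all of its components are; the inverses of
    the components then satisfy the modification law. *)

Record InvModification (B C : BicatData) (F G : PseudoFunctor B C)
  (s t : PseudoTrans F G) : Type := {
  inv_mod :> Modification s t;
  inv_mod_is_inv2 : forall a : B, is_inv2 (inv_mod a)
}.

Record Biequivalence (B C : Bicat) : Type := {
  beq_l : PseudoFunctor B C;
  beq_r : PseudoFunctor C B;
  beq_eta : PseudoTrans (comp_psf beq_r beq_l) (id_psf C);
  beq_eta_inv : PseudoTrans (id_psf C) (comp_psf beq_r beq_l);
  beq_eps : PseudoTrans (comp_psf beq_l beq_r) (id_psf B);
  beq_eps_inv : PseudoTrans (id_psf B) (comp_psf beq_l beq_r);
  beq_eta_eta_inv :
    InvModification (comp_ptrans beq_eta beq_eta_inv) (id_ptrans (comp_psf beq_r beq_l));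
  beq_eta_inv_eta :
    InvModification (comp_ptrans beq_eta_inv beq_eta) (id_ptrans (id_psf C));
  beq_eps_eps_inv :
    InvModification (comp_ptrans beq_eps beq_eps_inv) (id_ptrans (comp_psf beq_l beq_r));
  beq_eps_inv_eps :
    InvModification (comp_ptrans beq_eps_inv beq_eps) (id_ptrans (id_psf B))
}.

(* Main.v *)
Require Import Defs.

(** A monad [(m, η, μ)] gives the Kleisli extension [f^* = m f · μ]; conversely a
    Kleisli triple gives [m h = (h · η)^*] and [μ = id^*].  Both constructions keep
    the underlying category, the object map and the unit, and they are mutually
    inverse up to equations between morphisms.  Hence identities of [C] underlie the
    structure cells of the pseudofunctors, the unit and the counit, and their laws
    hold pointwise after cancelling identities.  On 1-cells, the invertible 2-cell
    [n_f : m_a · f ==> f · m_b] corresponds to the inverse of [F_M]. *)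

Set Implicit Arguments.
Unset Strict Implicit.
Unset Printing Implicit Defensive.

Close Scope bicat_scope.
Open Scope hom_scope.

(** * Cancelling identities and moving isomorphisms across equations *)

Ltac simpl_ids :=
  repeat (progress (rewrite ?fmap_id, ?kt_map_id, ?comp_id_l, ?comp_id_r)).

(** Evaluates a 2-cell law of [Cat] at an object. Whiskerings and unitors compute there, so the
    result is often the wanted pointwise equation by conversion alone. *)
Lemma nat_trans_at (C D : Category) (F G : Functor C D) (s t : NatTrans F G) :
  s = t -> forall x, s x = t x.
Proof. now intros ->. Qed.

Section IsoMoves.
  Context (C : Category) (x y z : C) (i : iso x y).

  Lemma iso_move_l (g : hom y z) (h : hom x z) : i · g = h -> g = iso_inv i · h.
  Proof. intros <-; now rewrite comp_assoc, iso_inv_mor, comp_id_l. Qed.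

  Lemma iso_inv_move_l (g : hom x z) (h : hom y z) : iso_inv i · g = h -> g = i · h.
  Proof. intros <-; now rewrite comp_assoc, iso_mor_inv, comp_id_l. Qed.

  Lemma iso_move_r (g : hom z x) (h : hom z y) : g · i = h -> g = h · iso_inv i.
  Proof. intros <-; now rewrite <- comp_assoc, iso_mor_inv, comp_id_r. Qed.

  Lemma iso_inv_move_r (g : hom z y) (h : hom z x) : g · iso_inv i = h -> g = h · i.
  Proof. intros <-; now rewrite <- comp_assoc, iso_inv_mor, comp_id_r. Qed.
End IsoMoves.

(** * From monads to Kleisli triples: objects *)

Section CatMonad.
  Context (S : Monad Cat).

  Let m : Functor (mnd_ob S) (mnd_ob S) := mnd_endo S.

  Definition cat_mnd_unit (x : univ_cat (mnd_ob S)) : hom x (m x) :=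
    nt (mnd_unit S : NatTrans (id_functor _) m) x.
  Definition cat_mnd_mult (x : univ_cat (mnd_ob S)) : hom (m (m x)) (m x) :=
    nt (mnd_mult S : NatTrans (comp_functor m m) m) x.

  Lemma cat_mnd_unit_natural (x y : univ_cat (mnd_ob S)) (f : hom x y) :
    f · cat_mnd_unit y = cat_mnd_unit x · fmap m f.
  Proof. exact (nt_natural (mnd_unit S : NatTrans (id_functor _) m) f). Qed.

  Lemma cat_mnd_mult_natural (x y : univ_cat (mnd_ob S)) (f : hom x y) :
    fmap m (fmap m f) · cat_mnd_mult y = cat_mnd_mult x · fmap m f.
  Proof. exact (nt_natural (mnd_mult S : NatTrans (comp_functor m m) m) f). Qed.

  (** In diagrammatic order [m ◁ η] has component [η] at [m x], while [η ▷ m] has component [fmap m]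
      of [η]. Hence [mnd_unit_r] gives this equation and [mnd_unit_l] the next one. *)
  Lemma cat_mnd_unit_mult (x : univ_cat (mnd_ob S)) :
    cat_mnd_unit (m x) · cat_mnd_mult x = idm (m x).
  Proof. exact (nat_trans_at (mnd_unit_r S) x). Qed.

  Lemma cat_mnd_fmap_unit_mult (x : univ_cat (mnd_ob S)) :
    fmap m (cat_mnd_unit x) · cat_mnd_mult x = idm (m x).
  Proof. exact (nat_trans_at (mnd_unit_l S) x). Qed.

  Lemma cat_mnd_mult_mult (x : univ_cat (mnd_ob S)) :
    cat_mnd_mult (m x) · cat_mnd_mult x = fmap m (cat_mnd_mult x) · cat_mnd_mult x.
  Proof.
    refine (eq_trans (nat_trans_at (mnd_assoc S) x) _); simpl.
    now rewrite comp_id_l.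
  Qed.

  Definition kleisli_of_monad : KleisliTriple.
  Proof.
    refine {| kt_cat := mnd_ob S;
              kt_ob := fun x => m x;
              kt_unit := cat_mnd_unit;
              kt_bind := fun a b f => fmap m f · cat_mnd_mult b |}.
    - apply cat_mnd_fmap_unit_mult.
    - abstract (intros; rewrite comp_assoc, <- cat_mnd_unit_natural, <- comp_assoc;
        now rewrite cat_mnd_unit_mult, comp_id_r).
    (* Associativity replaces [fmap m] of the last multiplication by the multiplication at [m c];
       naturality then carries it across [g]. *)
    - abstract (intros; rewrite !fmap_comp, <- !comp_assoc;
        rewrite <- cat_mnd_mult_mult, !comp_assoc; do 2 f_equal;
        rewrite <- !comp_assoc; f_equal; symmetry; apply cat_mnd_mult_natural).
  Defined.

  (** The action rebuilt from the triple is [fmap m (h · η) · μ], which agrees with [fmap m h] only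
      by the unit law. This is where the round trip on monads fails to be definitional. *)
  Lemma kt_map_kleisli_of_monad (x y : univ_cat (mnd_ob S)) (h : hom x y) :
    kt_map (C := kleisli_of_monad) h = fmap m h.
  Proof.
    unfold kt_map; simpl.
    now rewrite fmap_comp, <- comp_assoc, cat_mnd_fmap_unit_mult, comp_id_r.
  Qed.
End CatMonad.

(** * From monads to Kleisli triples: 1-cells and 2-cells *)

Section CatMonadMor.
  Context (S T : Monad Cat) (f : MonadMor S T).

  Let F : Functor (mnd_ob S) (mnd_ob T) := mnd_mor_cell1 f.
  Let m : Functor (mnd_ob S) (mnd_ob S) := mnd_endo S.
  Let m' : Functor (mnd_ob T) (mnd_ob T) := mnd_endo T.

  (** The cell of [f] is placed in the inverse field, since the isomorphism of a Kleisli morphism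
      points the other way. The laws of [f] can then be read off as laws of [iso_inv]. *)
  Definition cat_mor_iso (x : univ_cat (mnd_ob S)) : iso (m' (F x)) (F (m x)) :=
    {| iso_mor := nt (inv2 (mnd_mor_is_inv2 f)
                      : NatTrans (comp_functor F m') (comp_functor m F)) x;
       iso_inv := nt (mnd_mor_cell2 f
                      : NatTrans (comp_functor m F) (comp_functor F m')) x;
       iso_mor_inv := nat_trans_at (inv2_vcomp (mnd_mor_is_inv2 f)) x;
       iso_inv_mor := nat_trans_at (vcomp_inv2 (mnd_mor_is_inv2 f)) x |}.

  Lemma cat_mor_iso_natural (x y : univ_cat (mnd_ob S)) (h : hom x y) :
    fmap m' (fmap F h) · cat_mor_iso y = cat_mor_iso x · fmap F (fmap m h).
  Proof.
    exact (nt_natural (inv2 (mnd_mor_is_inv2 f)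
                      : NatTrans (comp_functor F m') (comp_functor m F)) h).
  Qed.

  Lemma cat_mor_inv_unit (x : univ_cat (mnd_ob S)) :
    fmap F (cat_mnd_unit x) · iso_inv (cat_mor_iso x) = cat_mnd_unit (F x).
  Proof.
    refine (eq_trans (nat_trans_at (mnd_mor_unit f) x) _); simpl.
    now simpl_ids.
  Qed.

  Lemma cat_mor_inv_mult (x : univ_cat (mnd_ob S)) :
    fmap F (cat_mnd_mult x) · iso_inv (cat_mor_iso x)
    = iso_inv (cat_mor_iso (m x)) · (fmap m' (iso_inv (cat_mor_iso x)) · cat_mnd_mult (F x)).
  Proof.
    refine (eq_trans (nat_trans_at (mnd_mor_mult f) x) _); simpl.
    now simpl_ids.
  Qed.

  (** This is [km_bind] for the identity of [m x], whose extension is the multiplication. It is the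
      multiplication law of [f] with both inverses moved to the opposite sides. *)
  Lemma cat_mor_iso_mult (x : univ_cat (mnd_ob S)) :
    cat_mor_iso (m x) · fmap F (cat_mnd_mult x)
    = fmap m' (iso_inv (cat_mor_iso x)) · cat_mnd_mult (F x) · cat_mor_iso x.
  Proof.
    apply iso_inv_move_r; rewrite <- comp_assoc; symmetry.
    apply iso_inv_move_l; symmetry; apply cat_mor_inv_mult.
  Qed.

  Definition kleisli_mor_of_monad_mor :
    KleisliMor (kleisli_of_monad S) (kleisli_of_monad T).
  Proof.
    refine (@Build_KleisliMor (kleisli_of_monad S) (kleisli_of_monad T) F cat_mor_iso _ _).
    - abstract (intro a; change (cat_mnd_unit (F a) · cat_mor_iso a = fmap F (cat_mnd_unit a));
        symmetry; apply iso_inv_move_r, cat_mor_inv_unit).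
    (* Naturality of the isomorphism brings [fmap m' (fmap F h)] to the front on both sides; what
       remains is the case of the identity. *)
    - abstract (intros a b h;
        change (cat_mor_iso a · fmap F (fmap m h · cat_mnd_mult b)
          = (fmap m' (fmap F h · iso_inv (cat_mor_iso b)) · cat_mnd_mult (F b)) · cat_mor_iso b);
        rewrite !fmap_comp, comp_assoc, <- cat_mor_iso_natural, <- !comp_assoc; f_equal;
        refine (eq_trans (cat_mor_iso_mult b) _); symmetry; apply comp_assoc).
  Defined.
End CatMonadMor.

Definition kleisli_cell_of_monad_cell (S T : Monad Cat) (f g : MonadMor S T)
  (x : MonadCell f g) :
  KleisliCell (kleisli_mor_of_monad_mor f) (kleisli_mor_of_monad_mor g).
Proof.
  refine (@Build_KleisliCell _ _ (kleisli_mor_of_monad_mor f) (kleisli_mor_of_monad_mor g)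
    (mnd_cell x) _).
  (* Both laws describe the same square, with the isomorphisms of [f] and [g] inverted. *)
  abstract (intro a; rewrite kt_map_kleisli_of_monad;
    apply iso_inv_move_r; rewrite <- comp_assoc; symmetry; apply iso_inv_move_l;
    exact (nat_trans_at (mnd_cell_law x) a)).
Defined.

(** * From Kleisli triples to monads *)

Section KleisliToMonad.
  Context (C : KleisliTriple).

  Definition kt_functor : Functor C C :=
    {| fob := fun x => kt_ob x;
       fmap := fun x y h => kt_map h;
       fmap_id := @kt_map_id C;
       fmap_comp := @kt_map_comp C |}.

  Definition kt_unit_nat : NatTrans (id_functor C) kt_functor.
  Proof.
    refine {| nt := fun x => kt_unit x : hom (id_functor C x) (kt_functor x) |}.
    abstract (intros; symmetry; apply kt_unit_map).
  Defined.

  Lemma kt_map_bind (x y z : C) (h : hom x y) (g : hom y (kt_ob z)) :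
    kt_map h · kt_bind g = kt_bind (h · g).
  Proof. unfold kt_map; now rewrite kt_bind_bind, <- comp_assoc, kt_unit_bind. Qed.

  Lemma kt_bind_map (x y z : C) (g : hom x (kt_ob y)) (h : hom y z) :
    kt_bind g · kt_map h = kt_bind (g · kt_map h).
  Proof. apply kt_bind_bind. Qed.

  Definition kt_mult_nat : NatTrans (comp_functor kt_functor kt_functor) kt_functor.
  Proof.
    refine {| nt := fun x => kt_bind (idm (kt_ob x))
                : hom (comp_functor kt_functor kt_functor x) (kt_functor x) |}.
    abstract (intros; simpl; now rewrite kt_map_bind, kt_bind_map, comp_id_l, comp_id_r).
  Defined.

  Definition monad_of_kleisli : Monad Cat.
  Proof.
    refine (@Build_Monad Cat (kt_cat C) kt_functor kt_unit_nat kt_mult_nat _ _ _);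
      apply nat_trans_eq; intro x; simpl.
    - abstract (apply kt_unit_bind).
    - abstract (now rewrite kt_map_bind, comp_id_r, kt_bind_unit).
    - abstract (now rewrite kt_map_bind, kt_bind_bind, !comp_id_l, comp_id_r).
  Defined.
End KleisliToMonad.

Section KleisliMorToMonadMor.
  Context (C D : KleisliTriple) (F : KleisliMor C D).

  (** Naturality is not postulated for the isomorphisms of a Kleisli morphism. It comes from
      [km_map], a consequence of [km_bind] and [km_unit], and passes to the inverses by moving both
      isomorphisms across. *)
  Definition km_inv_nat :
    NatTrans (comp_functor (kt_functor C) F) (comp_functor F (kt_functor D)).
  Proof.
    refine {| nt := fun x => iso_inv (km_iso F x)
                : hom (comp_functor (kt_functor C) F x) (comp_functor F (kt_functor D) x) |}.
    abstract (intros x y h; simpl;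
      symmetry; apply iso_move_r; rewrite <- comp_assoc; symmetry; apply iso_move_l, km_map).
  Defined.

  Definition km_iso_nat :
    NatTrans (comp_functor F (kt_functor D)) (comp_functor (kt_functor C) F).
  Proof.
    refine {| nt := fun x => iso_mor (km_iso F x)
                : hom (comp_functor F (kt_functor D) x) (comp_functor (kt_functor C) F x) |}.
    abstract (intros x y h; simpl; symmetry; apply km_map).
  Defined.

  Definition km_inv_nat_is_inv2 :
    @is_inv2 Cat (kt_cat C) (kt_cat D)
      (comp_functor (kt_functor C) F) (comp_functor F (kt_functor D)) km_inv_nat.
  Proof.
    exists km_iso_nat.
    - abstract (apply nat_trans_eq; intro x; apply iso_inv_mor).
    - abstract (apply nat_trans_eq; intro x; apply iso_mor_inv).
  Defined.

  Definition monad_mor_of_kleisli_mor :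
    MonadMor (monad_of_kleisli C) (monad_of_kleisli D).
  Proof.
    refine (@Build_MonadMor Cat (monad_of_kleisli C) (monad_of_kleisli D)
      (km_functor F) km_inv_nat km_inv_nat_is_inv2 _ _);
      apply nat_trans_eq; intro x; simpl.
    - abstract (rewrite <- km_unit, <- comp_assoc, iso_mor_inv; now simpl_ids).
    (* Once the two inverses are moved across, the multiplication law is [km_bind] at the identity
       of [kt_ob x]. *)
    - abstract (simpl_ids;
        rewrite kt_map_bind, comp_id_r; symmetry;
        apply iso_move_r; rewrite <- comp_assoc; symmetry; apply iso_move_l;
        now rewrite km_bind, fmap_id, comp_id_l).
  Defined.
End KleisliMorToMonadMor.

Definition monad_cell_of_kleisli_cell (C D : KleisliTriple) (F G : KleisliMor C D)
  (x : KleisliCell F G) :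
  MonadCell (monad_mor_of_kleisli_mor F) (monad_mor_of_kleisli_mor G).
Proof.
  refine (@Build_MonadCell Cat _ _ (monad_mor_of_kleisli_mor F) (monad_mor_of_kleisli_mor G)
    (kc_nat x) _).
  abstract (apply nat_trans_eq; intro a; simpl;
    apply iso_move_r; rewrite <- comp_assoc; symmetry; apply iso_move_l, kc_law).
Defined.

(** * Invertibility of 2-cells from pointwise isomorphisms *)

Definition nat_trans_inv (C D : Category) (F G : Functor C D) (x : NatTrans F G)
  (i : forall a, iso (F a) (G a)) (E : forall a, x a = i a) : NatTrans G F.
Proof.
  refine {| nt := fun a => iso_inv (i a) |}.
  abstract (intros a b h; symmetry; apply iso_move_r; rewrite <- comp_assoc; symmetry;
    apply iso_move_l; rewrite <- !E; symmetry; apply nt_natural).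
Defined.

(** The isomorphisms are an argument separate from [x], so that the inverse can be prescribed. If
    the components of [x] are definitionally identities, [id_iso] and [eq_refl] suffice. *)
Definition nat_trans_is_inv2 (C D : UnivCat) (F G : Functor C D) (x : NatTrans F G)
  (i : forall a, iso (F a) (G a)) (E : forall a, x a = i a) : @is_inv2 Cat C D F G x.
Proof.
  exists (nat_trans_inv E).
  - abstract (apply nat_trans_eq; intro a; simpl; rewrite E; apply iso_mor_inv).
  - abstract (apply nat_trans_eq; intro a; simpl; rewrite E; apply iso_inv_mor).
Defined.

Definition kleisli_cell_is_inv2 (C D : KleisliTriple) (F G : KleisliMor C D)
  (x : KleisliCell F G) (i : forall a, iso (F a) (G a)) (E : forall a, x a = i a) :
  @is_inv2 KleisliBicat C D F G x.
Proof.
  unshelve eexists.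
  - refine (@Build_KleisliCell C D G F (nat_trans_inv E) _).
    (* The law of [x] produces [kt_map] of the inverse followed by [kt_map] of the component, which
       functoriality of [kt_map] cancels. *)
    abstract (intro a; simpl; symmetry; apply iso_move_r;
      rewrite <- comp_assoc, <- E, kc_law, comp_assoc, <- kt_map_comp, E, iso_inv_mor;
      now rewrite kt_map_id, comp_id_l).
  - abstract (apply kleisli_cell_eq; intro a; simpl; rewrite E; apply iso_mor_inv).
  - abstract (apply kleisli_cell_eq; intro a; simpl; rewrite E; apply iso_inv_mor).
Defined.

Definition monad_cell_is_inv2 (S T : Monad Cat) (f g : MonadMor S T) (x : MonadCell f g)
  (i : forall a : univ_cat (mnd_ob S),
     iso ((mnd_mor_cell1 f : Functor _ _) a) ((mnd_mor_cell1 g : Functor _ _) a))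
  (E : forall a, nt (mnd_cell x : NatTrans _ _) a = i a) :
  @is_inv2 (MonadBicat Cat) S T f g x.
Proof.
  pose (Hx := nat_trans_is_inv2 E : is_inv2 (mnd_cell x)).
  exists (mnd_inv2 Hx).
  - abstract (apply mnd_cell_eq, (vcomp_inv2 Hx)).
  - abstract (apply mnd_cell_eq, (inv2_vcomp Hx)).
Defined.

(** * The two pseudofunctors *)

Ltac kleisli_ids :=
  intros; apply kleisli_cell_eq; intro; simpl; simpl_ids; try reflexivity.
Ltac monad_ids :=
  intros; apply mnd_cell_eq, nat_trans_eq; intro; simpl; simpl_ids; try reflexivity.

Definition monad_to_kleisli_id (S : Monad Cat) :
  KleisliCell (kleisli_id1 (kleisli_of_monad S)) (kleisli_mor_of_monad_mor (mnd_id1 S)).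
Proof.
  refine (@Build_KleisliCell _ _ (kleisli_id1 (kleisli_of_monad S))
    (kleisli_mor_of_monad_mor (mnd_id1 S)) (id_nat (id_functor _)) _).
  abstract (intro a; rewrite kt_map_id; simpl; now simpl_ids).
Defined.

(** Both morphisms have the same underlying functor. Up to associators, the inverse of
    [mnd_comp1_cell2] is the composite of isomorphisms used in [kleisli_comp1], so identities form a
    cell. *)
Definition monad_to_kleisli_comp (S T U : Monad Cat) (f : MonadMor S T) (g : MonadMor T U) :
  KleisliCell (kleisli_comp1 (kleisli_mor_of_monad_mor f) (kleisli_mor_of_monad_mor g))
    (kleisli_mor_of_monad_mor (mnd_comp1 f g)).
Proof.
  refine (@Build_KleisliCell _ _
    (kleisli_comp1 (kleisli_mor_of_monad_mor f) (kleisli_mor_of_monad_mor g))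
    (kleisli_mor_of_monad_mor (mnd_comp1 f g))
    (id_nat (comp_functor (mnd_mor_cell1 f) (mnd_mor_cell1 g))) _).
  abstract (intro a; rewrite kt_map_id; simpl; now simpl_ids).
Defined.

Definition monad_to_kleisli : PseudoFunctor (MonadBicat Cat) KleisliBicat.
Proof.
  refine (@Build_PseudoFunctor (MonadBicat Cat) KleisliBicat
    kleisli_of_monad kleisli_mor_of_monad_mor kleisli_cell_of_monad_cell
    monad_to_kleisli_id monad_to_kleisli_comp
    (fun S => kleisli_cell_is_inv2 (x := monad_to_kleisli_id S) (i := fun a => id_iso _) (fun a => eq_refl))
    (fun S T U f g => kleisli_cell_is_inv2 (x := monad_to_kleisli_comp f g)
      (i := fun a => id_iso _) (fun a => eq_refl))
    _ _ _ _ _ _ _); abstract kleisli_ids.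
Defined.

Definition kleisli_to_monad_id (C : KleisliTriple) :
  MonadCell (mnd_id1 (monad_of_kleisli C)) (monad_mor_of_kleisli_mor (kleisli_id1 C)).
Proof.
  refine (@Build_MonadCell _ _ _ (mnd_id1 (monad_of_kleisli C))
    (monad_mor_of_kleisli_mor (kleisli_id1 C)) (id_nat (id_functor _)) _).
  abstract (apply nat_trans_eq; intro a; simpl; now simpl_ids).
Defined.

Definition kleisli_to_monad_comp (C D E : KleisliTriple)
  (F : KleisliMor C D) (G : KleisliMor D E) :
  MonadCell (mnd_comp1 (monad_mor_of_kleisli_mor F) (monad_mor_of_kleisli_mor G))
    (monad_mor_of_kleisli_mor (kleisli_comp1 F G)).
Proof.
  refine (@Build_MonadCell _ _ _
    (mnd_comp1 (monad_mor_of_kleisli_mor F) (monad_mor_of_kleisli_mor G))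
    (monad_mor_of_kleisli_mor (kleisli_comp1 F G)) (id_nat (comp_functor F G)) _).
  abstract (apply nat_trans_eq; intro a; simpl; now simpl_ids).
Defined.

Definition kleisli_to_monad : PseudoFunctor KleisliBicat (MonadBicat Cat).
Proof.
  refine (@Build_PseudoFunctor KleisliBicat (MonadBicat Cat)
    monad_of_kleisli monad_mor_of_kleisli_mor monad_cell_of_kleisli_cell
    kleisli_to_monad_id kleisli_to_monad_comp
    (fun C => monad_cell_is_inv2 (x := kleisli_to_monad_id C)
                (i := fun a => id_iso _) (fun a => eq_refl))
    (fun C D E F G => monad_cell_is_inv2 (x := kleisli_to_monad_comp F G)
                (i := fun a => id_iso _) (fun a => eq_refl))
    _ _ _ _ _ _ _); abstract monad_ids.
Defined.

(** This is [lunitor] followed by [rinvunitor], given in one piece: its components are then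
    definitionally identities instead of composites of two identities. *)
Definition unit_swap_nat (C D : Category) (F : Functor C D) :
  NatTrans (comp_functor (id_functor C) F) (comp_functor F (id_functor D)).
Proof.
  refine {| nt := fun a => idm (F a)
              : hom (comp_functor (id_functor C) F a) (comp_functor F (id_functor D) a) |}.
  abstract (intros; simpl; now simpl_ids).
Defined.

(** * The round trip on Kleisli triples *)

Section KleisliCounit.
  Context (C : KleisliTriple).

  Local Notation C' := (kleisli_of_monad (monad_of_kleisli C)).

  (** The triples [C'] and [C] differ only in their extension: in [C'] it is
      [kt_map f · kt_bind (idm _)], which [kt_map_bind] identifies with [kt_bind f]. The identity
      functor is thus a morphism in both directions. *)
  Definition kleisli_counit : KleisliMor C' C.
  Proof.
    refine (@Build_KleisliMor C' C (id_functor C) (fun a => id_iso (kt_ob a)) _ _).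
    - abstract (intros; apply comp_id_r).
    - abstract (intros; simpl; unfold cat_mnd_mult; simpl; simpl_ids;
        now rewrite kt_map_bind, comp_id_r).
  Defined.

  Definition kleisli_counit_inv : KleisliMor C C'.
  Proof.
    refine (@Build_KleisliMor C C' (id_functor C) (fun a => id_iso (kt_ob a)) _ _).
    - abstract (intros; apply comp_id_r).
    - abstract (intros; simpl; unfold cat_mnd_mult; simpl; simpl_ids;
        now rewrite kt_map_bind, comp_id_r).
  Defined.
End KleisliCounit.

Definition kleisli_counit_cell (C D : KleisliTriple) (F : KleisliMor C D) :
  KleisliCell (kleisli_comp1 (kleisli_counit C) F)
    (kleisli_comp1 (kleisli_mor_of_monad_mor (monad_mor_of_kleisli_mor F)) (kleisli_counit D)).
Proof.
  refine (@Build_KleisliCell _ _ (kleisli_comp1 (kleisli_counit C) F)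
    (kleisli_comp1 (kleisli_mor_of_monad_mor (monad_mor_of_kleisli_mor F)) (kleisli_counit D))
    (unit_swap_nat F) _).
  abstract (intro a; simpl; now simpl_ids).
Defined.

Definition kleisli_counit_inv_cell (C D : KleisliTriple) (F : KleisliMor C D) :
  KleisliCell
    (kleisli_comp1 (kleisli_counit_inv C)
      (kleisli_mor_of_monad_mor (monad_mor_of_kleisli_mor F)))
    (kleisli_comp1 F (kleisli_counit_inv D)).
Proof.
  refine (@Build_KleisliCell _ _
    (kleisli_comp1 (kleisli_counit_inv C)
      (kleisli_mor_of_monad_mor (monad_mor_of_kleisli_mor F)))
    (kleisli_comp1 F (kleisli_counit_inv D))
    (unit_swap_nat F) _).
  (* The component of [unit_swap_nat] is convertible to an identity, so [kt_map_id] is applied up to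
     conversion. *)
  abstract (intro a; refine (eq_trans _ (f_equal (fun u => u · _) (eq_sym (kt_map_id _)))); simpl; now simpl_ids).
Defined.

Definition kleisli_eta :
  PseudoTrans (comp_psf kleisli_to_monad monad_to_kleisli) (id_psf KleisliBicat).
Proof.
  refine (@Build_PseudoTrans KleisliBicat KleisliBicat
    (comp_psf kleisli_to_monad monad_to_kleisli) (id_psf KleisliBicat)
    kleisli_counit kleisli_counit_cell
    (fun C D F => kleisli_cell_is_inv2 (x := kleisli_counit_cell F)
                    (i := fun a => id_iso _) (fun a => eq_refl)) _ _ _);
  unfold ptrans_natural_law, ptrans_id_law, ptrans_comp_law; abstract kleisli_ids.
Defined.

Definition kleisli_eta_inv :
  PseudoTrans (id_psf KleisliBicat) (comp_psf kleisli_to_monad monad_to_kleisli).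
Proof.
  refine (@Build_PseudoTrans KleisliBicat KleisliBicat
    (id_psf KleisliBicat) (comp_psf kleisli_to_monad monad_to_kleisli)
    kleisli_counit_inv kleisli_counit_inv_cell
    (fun C D F => kleisli_cell_is_inv2 (x := kleisli_counit_inv_cell F)
                    (i := fun a => id_iso _) (fun a => eq_refl)) _ _ _);
  unfold ptrans_natural_law, ptrans_id_law, ptrans_comp_law; abstract kleisli_ids.
Defined.

(** * The round trip on monads *)

Section MonadCounit.
  Context (S : Monad Cat).

  Let m : Functor (mnd_ob S) (mnd_ob S) := mnd_endo S.

  Local Notation S' := (monad_of_kleisli (kleisli_of_monad S)).

  (** The two endofunctors agree on objects, and on morphisms by [kt_map_kleisli_of_monad]; this
      makes the identities natural. *)
  Definition monad_counit_nat :
    NatTrans (comp_functor (kt_functor (kleisli_of_monad S)) (id_functor _))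
      (comp_functor (id_functor _) m).
  Proof.
    refine {| nt := fun a => idm (m a)
                : hom (comp_functor (kt_functor (kleisli_of_monad S)) (id_functor _) a)
                    (comp_functor (id_functor _) m a) |}.
    abstract (intros; rewrite comp_id_l, comp_id_r; apply kt_map_kleisli_of_monad).
  Defined.

  Definition monad_counit_inv_nat :
    NatTrans (comp_functor m (id_functor _))
      (comp_functor (id_functor _) (kt_functor (kleisli_of_monad S))).
  Proof.
    refine {| nt := fun a => idm (m a)
                : hom (comp_functor m (id_functor _) a)
                    (comp_functor (id_functor _) (kt_functor (kleisli_of_monad S)) a) |}.
    abstract (intros; rewrite comp_id_l, comp_id_r; symmetry; apply kt_map_kleisli_of_monad).
  Defined.

  Definition monad_counit : MonadMor S' S.
  Proof.
    refine (@Build_MonadMor Cat S' S (id_functor (mnd_ob S)) monad_counit_nat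
      (nat_trans_is_inv2 (x := monad_counit_nat) (i := fun a => id_iso _) (fun a => eq_refl))
      _ _); apply nat_trans_eq; intro a; simpl.
    - abstract (now simpl_ids).
    - abstract (now simpl_ids).
  Defined.

  Definition monad_counit_inv : MonadMor S S'.
  Proof.
    refine (@Build_MonadMor Cat S S' (id_functor (mnd_ob S)) monad_counit_inv_nat
      (nat_trans_is_inv2 (x := monad_counit_inv_nat) (i := fun a => id_iso _) (fun a => eq_refl))
      _ _); apply nat_trans_eq; intro a; simpl.
    - abstract (now simpl_ids).
    (* The target is now [S'], so whiskering applies the action of [S'] to an identity. That unfolds
       to [fmap m η · μ], and the unit law of [S] removes it. *)
    - abstract (simpl_ids; now rewrite cat_mnd_fmap_unit_mult, comp_id_l).
  Defined.
End MonadCounit.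

Definition monad_counit_cell (S T : Monad Cat) (f : MonadMor S T) :
  MonadCell (mnd_comp1 (monad_counit S) f)
    (mnd_comp1 (monad_mor_of_kleisli_mor (kleisli_mor_of_monad_mor f)) (monad_counit T)).
Proof.
  refine (@Build_MonadCell Cat _ _ (mnd_comp1 (monad_counit S) f)
    (mnd_comp1 (monad_mor_of_kleisli_mor (kleisli_mor_of_monad_mor f)) (monad_counit T))
    (unit_swap_nat (mnd_mor_cell1 f)) _).
  abstract (apply nat_trans_eq; intro a; simpl; now simpl_ids).
Defined.

Definition monad_counit_inv_cell (S T : Monad Cat) (f : MonadMor S T) :
  MonadCell
    (mnd_comp1 (monad_counit_inv S)
      (monad_mor_of_kleisli_mor (kleisli_mor_of_monad_mor f)))
    (mnd_comp1 f (monad_counit_inv T)).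
Proof.
  refine (@Build_MonadCell Cat _ _
    (mnd_comp1 (monad_counit_inv S)
      (monad_mor_of_kleisli_mor (kleisli_mor_of_monad_mor f)))
    (mnd_comp1 f (monad_counit_inv T))
    (unit_swap_nat (mnd_mor_cell1 f)) _).
  abstract (apply nat_trans_eq; intro a; simpl; simpl_ids;
    now rewrite cat_mnd_fmap_unit_mult, comp_id_r).
Defined.

Definition monad_eps :
  PseudoTrans (comp_psf monad_to_kleisli kleisli_to_monad) (id_psf (MonadBicat Cat)).
Proof.
  refine (@Build_PseudoTrans (MonadBicat Cat) (MonadBicat Cat)
    (comp_psf monad_to_kleisli kleisli_to_monad) (id_psf (MonadBicat Cat))
    monad_counit monad_counit_cell
    (fun S T f => monad_cell_is_inv2 (x := monad_counit_cell f)
                    (i := fun a => id_iso _) (fun a => eq_refl)) _ _ _);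
  unfold ptrans_natural_law, ptrans_id_law, ptrans_comp_law; abstract monad_ids.
Defined.

Definition monad_eps_inv :
  PseudoTrans (id_psf (MonadBicat Cat)) (comp_psf monad_to_kleisli kleisli_to_monad).
Proof.
  refine (@Build_PseudoTrans (MonadBicat Cat) (MonadBicat Cat)
    (id_psf (MonadBicat Cat)) (comp_psf monad_to_kleisli kleisli_to_monad)
    monad_counit_inv monad_counit_inv_cell
    (fun S T f => monad_cell_is_inv2 (x := monad_counit_inv_cell f)
                    (i := fun a => id_iso _) (fun a => eq_refl)) _ _ _);
  unfold ptrans_natural_law, ptrans_id_law, ptrans_comp_law; abstract monad_ids.
Defined.

(** * Components of the four modifications *)

Definition kleisli_counit_counit_inv (C : KleisliTriple) :
  KleisliCell (kleisli_comp1 (kleisli_counit C) (kleisli_counit_inv C))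
    (kleisli_id1 (kleisli_of_monad (monad_of_kleisli C))).
Proof.
  (* Both counits lie over the identity functor, so the comparison of their composite with the
     identity is the unitor of the identity functor. *)
  refine (@Build_KleisliCell _ _ (kleisli_comp1 (kleisli_counit C) (kleisli_counit_inv C))
    (kleisli_id1 (kleisli_of_monad (monad_of_kleisli C))) (lunitor_nat (id_functor C)) _).
  abstract (intro a; refine (eq_trans _ (f_equal (fun u => u · _) (eq_sym (kt_map_id _))));
    simpl; now simpl_ids).
Defined.

Definition kleisli_counit_inv_counit (C : KleisliTriple) :
  KleisliCell (kleisli_comp1 (kleisli_counit_inv C) (kleisli_counit C)) (kleisli_id1 C).
Proof.
  refine (@Build_KleisliCell _ _ (kleisli_comp1 (kleisli_counit_inv C) (kleisli_counit C))
    (kleisli_id1 C) (lunitor_nat (id_functor C)) _).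
  abstract (intro a; refine (eq_trans _ (f_equal (fun u => u · _) (eq_sym (kt_map_id _))));
    simpl; now simpl_ids).
Defined.

Definition monad_counit_counit_inv (S : Monad Cat) :
  MonadCell (mnd_comp1 (monad_counit S) (monad_counit_inv S))
    (mnd_id1 (monad_of_kleisli (kleisli_of_monad S))).
Proof.
  refine (@Build_MonadCell Cat _ _ (mnd_comp1 (monad_counit S) (monad_counit_inv S))
    (mnd_id1 (monad_of_kleisli (kleisli_of_monad S)))
    (lunitor_nat (id_functor (mnd_ob S))) _).
  abstract (apply nat_trans_eq; intro a; simpl; simpl_ids;
    now rewrite cat_mnd_fmap_unit_mult).
Defined.

Definition monad_counit_inv_counit (S : Monad Cat) :
  MonadCell (mnd_comp1 (monad_counit_inv S) (monad_counit S)) (mnd_id1 S).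
Proof.
  refine (@Build_MonadCell Cat _ _ (mnd_comp1 (monad_counit_inv S) (monad_counit S))
    (mnd_id1 S) (lunitor_nat (id_functor (mnd_ob S))) _).
  abstract (apply nat_trans_eq; intro a; simpl; now simpl_ids).
Defined.

Theorem mainTheorem8 : Biequivalence (MonadBicat Cat) KleisliBicat.
Proof.
  refine (@Build_Biequivalence (MonadBicat Cat) KleisliBicat
    monad_to_kleisli kleisli_to_monad
    kleisli_eta kleisli_eta_inv monad_eps monad_eps_inv _ _ _ _).
  (* The components are identities, hence inverted by [id_iso]. The remaining goal is the
     modification law, where all identities cancel pointwise; the other three cases follow the same
     pattern. *)
  - refine (@Build_InvModification KleisliBicat KleisliBicat _ _
      (comp_ptrans kleisli_eta kleisli_eta_inv) (id_ptrans _)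
      (@Build_Modification KleisliBicat KleisliBicat _ _
         (comp_ptrans kleisli_eta kleisli_eta_inv) (id_ptrans _) kleisli_counit_counit_inv _)
      (fun C => kleisli_cell_is_inv2 (x := kleisli_counit_counit_inv C)
         (i := fun a => id_iso _) (fun a => eq_refl))).
    kleisli_ids.
  - refine (@Build_InvModification KleisliBicat KleisliBicat _ _
      (comp_ptrans kleisli_eta_inv kleisli_eta) (id_ptrans _)
      (@Build_Modification KleisliBicat KleisliBicat _ _
         (comp_ptrans kleisli_eta_inv kleisli_eta) (id_ptrans _) kleisli_counit_inv_counit _)
      (fun C => kleisli_cell_is_inv2 (x := kleisli_counit_inv_counit C)
         (i := fun a => id_iso _) (fun a => eq_refl))).
    kleisli_ids.
  - refine (@Build_InvModification (MonadBicat Cat) (MonadBicat Cat) _ _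
      (comp_ptrans monad_eps monad_eps_inv) (id_ptrans _)
      (@Build_Modification (MonadBicat Cat) (MonadBicat Cat) _ _
         (comp_ptrans monad_eps monad_eps_inv) (id_ptrans _)
         monad_counit_counit_inv _)
      (fun S => monad_cell_is_inv2 (x := monad_counit_counit_inv S)
         (i := fun a => id_iso _) (fun a => eq_refl))).
    monad_ids.
  - refine (@Build_InvModification (MonadBicat Cat) (MonadBicat Cat) _ _
      (comp_ptrans monad_eps_inv monad_eps) (id_ptrans _)
      (@Build_Modification (MonadBicat Cat) (MonadBicat Cat) _ _
         (comp_ptrans monad_eps_inv monad_eps) (id_ptrans _)
         monad_counit_inv_counit _)
      (fun S => monad_cell_is_inv2 (x := monad_counit_inv_counit S)
         (i := fun a => id_iso _) (fun a => eq_refl))).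
    monad_ids.
Qed.
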